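(* Let $n\ge1$, $p>1$, $\alpha>0$, $s>1$ and $p'=p/(p-1)$. Then $$[(M^{\alpha,s}_p)']^*=(B^{\alpha,s}_{p'})^*=M^{\alpha,s}_p,$$ with equalities of norms (isometric isomorphisms).
   Context: $G_\alpha=\mathcal{F}^{-1}[(1+|\xi|^2)^{-\alpha/2}]$ is the Bessel kernel of order $\alpha$ on $\mathbb{R}^n$. For $E\subset\mathbb{R}^n$ the Bessel capacity is ${\rm Cap}_{\alpha,s}(E)=\inf\{\|f\|_{L^s}^s: f\ge 0,\ G_\alpha*f\ge 1 \text{ on } E\}$. For $p\ge1$, $M^{\alpha,s}_p$ is the space of $f\in L^p_{\rm loc}(\mathbb{R}^n)$ with finite norm $\|f\|_{M^{\alpha,s}_p}=\sup_K\big(\int_K|f|^p\,dx/{\rm Cap}_{\alpha,s}(K)\big)^{1/p}$, the supremum over all compact $K\subset\mathbb{R}^n$ with ${\rm Cap}_{\alpha,s}(K)\neq 0$. The Köthe dual $(M^{\alpha,s}_p)'$ is the space of measurable $f$ with $\|f\|_{(M^{\alpha,s}_p)'}=\sup\{\int|fg|\,dx:\ \|g\|_{M^{\alpha,s}_p}\le1\}<\infty$. For $q>1$, $B^{\alpha,s}_q$ is the space of all functions $f$ of the form $f=\sum_jc_ja_j$ (convergence pointwise a.e.), where $\{c_j\}\in\ell^1$ and each $a_j\in L^q(\mathbb{R}^n)$ is such that there is a bounded set $A_j\subset\mathbb{R}^n$ with $a_j=0$ a.e. in $\mathbb{R}^n\setminus A_j$ and $\|a_j\|_{L^q}\le{\rm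 Cap}_{\alpha,s}(A_j)^{\frac{1-q}{q}}$. Its norm is $\|f\|_{B^{\alpha,s}_q}=\inf\{\sum_j|c_j|: f=\sum_jc_ja_j\text{ a.e.}\}$ over all such representations. $X^*$ denotes the dual space of bounded linear functionals with the operator norm. *)

(* Defs.v *)
From HB Require Import structures.
From mathcomp Require Import all_boot all_order all_algebra.
From mathcomp Require Import complex.
From mathcomp Require Import all_classical all_reals all_analysis.
From mathcomp Require Import measurable_realfun.

Set Implicit Arguments.
Unset Strict Implicit.
Unset Printing Implicit Defensive.

Import Order.TTheory GRing.Theory Num.Theory.
Import numFieldNormedType.Exports.

Local Open Scope classical_set_scope.
Local Open Scope ring_scope.

Section borel_rV.
Context {R : realType} (n : nat).

Let rV_set0 : <<s @open 'rV[R]_n >> set0.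
Proof. exact: sigma_algebra0. Qed.

Let rV_setC (A : set 'rV[R]_n) : <<s open >> A -> <<s open >> (~` A).
Proof. exact: sigma_algebraC. Qed.

Let rV_bigcup (F : (set 'rV[R]_n)^nat) :
  (forall i, <<s open >> (F i)) -> <<s open >> (\bigcup_i (F i)).
Proof. exact: sigma_algebra_bigcup. Qed.

HB.instance Definition _ := @isMeasurable.Build (sigma_display (@open 'rV[R]_n))
  'rV[R]_n <<s open >> rV_set0 rV_setC rV_bigcup.

End borel_rV.

Section measurable_rV.
Context {R : realType}.

Lemma open_measurable_rV n (A : set 'rV[R]_n) : open A -> measurable A.
Proof. by move=> oA; exact: sub_sigma_algebra. Qed.

Lemma measurable_coord n (i : 'I_n) :
  measurable_fun [set: 'rV[R]_n] (fun x : 'rV[R]_n => x ord0 i).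
Proof.
apply: (measurability _ (RGenOpens.measurableE R)).
move=> _ [_ [a [b ->]] <-]; rewrite setTI.
apply: open_measurable_rV; apply: open_comp; last exact: interval_open.
by move=> x _; exact: coord_continuous.
Qed.

Let qbox n (qk : 'rV[rat]_n * nat) : set 'rV[R]_n :=
  \bigcap_(i in [set: 'I_n])
    [set x : 'rV[R]_n | ball (ratr (qk.1 ord0 i) : R) qk.2.+1%:R^-1 (x ord0 i)].

Let open_qboxE n (A : set 'rV[R]_n) : open A ->
  A = \bigcup_(qk in [set qk | qbox qk `<=` A]) qbox qk.
Proof.
move=> oA; apply/seteqP; split=> [x Ax|x [qk /= sA qkx]]; last exact: sA.
have /nbhs_ballP[e /= e0 xeA] : nbhs x A by exact: open_nbhs_nbhs.
have e2 : 0 < e / 2 by rewrite divr_gt0.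
have [k _ /(_ k (leqnn k)) /= ke] := near_infty_natSinv_lt (PosNum e2).
have k0 : 0 < k.+1%:R^-1 :> R by rewrite invr_gt0.
have H i : exists q : rat, ball (ratr q : R) k.+1%:R^-1 (x ord0 i).
  have [q] : exists q : rat, ratr q \in `]x ord0 i, (x ord0 i + k.+1%:R^-1)[.
    by apply: rat_in_itvoo; rewrite ltrDl.
  rewrite in_itv /= => /andP[q1 q2]; exists q.
  by rewrite /ball /= ger0_norm ?subr_ge0 1?ltW// ltrBlDl.
have [q /= Hq] := @choice _ _ _ H.
have qx : qbox (\row_i q i, k) x by move=> i _ /=; rewrite mxE; exact: Hq.
exists (\row_i q i, k) => //= y qy; apply: xeA; split=> // i j.
rewrite (ord1 i) [e]splitr; apply: (@le_ball _ _ _ (k.+1%:R^-1 + k.+1%:R^-1)).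
  by rewrite lerD// ltW.
by apply: ball_triangle (qy j I); apply: ball_sym; exact: qx.
Qed.

Lemma measurable_fun_rVP d (T : measurableType d) n (f : T -> 'rV[R]_n) :
  measurable_fun [set: T] f <->
  forall i, measurable_fun [set: T] (fun x => f x ord0 i).
Proof.
split=> [mf i|mf].
  by apply: (measurableT_comp (measurable_coord i)).
apply: (@measurability _ _ _ _ setT f (@open 'rV[R]_n)) => //.
move=> _ [A oA <-]; rewrite setTI (open_qboxE oA) preimage_bigcup bigcup_mkcond.
apply: countable_bigcupT_measurable => [|qk]; first exact: countableP.
case: ifPn => // _; rewrite preimage_bigcap.
apply: fin_bigcap_measurable => // i _.
rewrite -[X in measurable X]setTI.
rewrite (_ : _ @^-1` _ = (fun x => f x ord0 i) @^-1`
  (ball (ratr (qk.1 ord0 i) : R) qk.2.+1%:R^-1))//.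
by apply: mf => //; apply: open_measurable; exact: ball_open.
Qed.

End measurable_rV.

Section lebesgue_rV.
Context {R : realType}.

Definition rV_cons n (p : measurableTypeR R * 'rV[R]_n) : 'rV[R]_n.+1 :=
  \row_i if unlift ord0 i is Some j then p.2 ord0 j else p.1.

Lemma measurable_rV_cons n : measurable_fun setT (@rV_cons n).
Proof.
apply/measurable_fun_rVP => i; under eq_fun do rewrite mxE.
case: unliftP => [j _|_]; last exact: measurable_fst.
exact: (measurableT_comp (measurable_coord j) measurable_snd).
Qed.

Section lebesgue_rVS.
Context n (m : {sigma_finite_measure set 'rV[R]_n -> \bar R}).

Definition lebesgue_rVS : set 'rV[R]_n.+1 -> \bar R :=
  pushforward (@lebesgue_measure R \x m)%E (@rV_cons n).

HB.instance Definition _ := Measure.copy lebesgue_rVS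
  (measure_function_pushforward__canonical__measure_function_Measure
     (@lebesgue_measure R \x m)%E (@measurable_rV_cons n)).

Let lebesgue_rVS_sigma_finite : sigma_finite setT lebesgue_rVS.
Proof.
have /sigma_finiteP[F [TF ndF Foo]] := sigma_finiteT (@lebesgue_measure R).
have /sigma_finiteP[G [TG ndG Goo]] := sigma_finiteT m.
pose h1 (x : 'rV[R]_n.+1) : measurableTypeR R := x ord0 ord0.
pose h2 (x : 'rV[R]_n.+1) : 'rV[R]_n := \row_i x ord0 (lift ord0 i).
have mh1 : measurable_fun setT h1 by exact: measurable_coord.
have mh2 : measurable_fun setT h2.
  apply/measurable_fun_rVP => i; under eq_fun do rewrite mxE.
  exact: measurable_coord.
have h1K a x : h1 (rV_cons (a, x)) = a by rewrite /h1 mxE unlift_none.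
have h2K a x : h2 (rV_cons (a, x)) = x.
  by apply/rowP => i; rewrite !mxE liftK.
exists (fun k => h1 @^-1` F k `&` h2 @^-1` G k).
  apply/seteqP; split => // x _.
  have [k _ Fk] : (\bigcup_i F i) (h1 x) by rewrite -TF.
  have [l _ Gl] : (\bigcup_i G i) (h2 x) by rewrite -TG.
  exists (maxn k l) => //; split.
    by apply: (subsetPset _ _ (ndF _ _ (leq_maxl k l))).
  by apply: (subsetPset _ _ (ndG _ _ (leq_maxr k l))).
move=> k; have [mF Fk] := Foo k; have [mG Gk] := Goo k; split.
  by apply: measurableI; rewrite -[X in measurable X]setTI;
    [exact: mh1|exact: mh2].
rewrite /lebesgue_rVS /pushforward (_ : _ @^-1` _ = F k `*` G k).
  by rewrite product_measure1E// lte_mul_pinfty// ge0_fin_numE.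
by apply/seteqP; split=> -[a x] /=; rewrite h1K h2K.
Qed.

HB.instance Definition _ := Measure_isSigmaFinite.Build _ _ _ lebesgue_rVS
  lebesgue_rVS_sigma_finite.

End lebesgue_rVS.

Fixpoint lebesgue_rV n : {sigma_finite_measure set 'rV[R]_n -> \bar R} :=
  match n with
  | 0 => \d_(0 : 'rV[R]_0)
  | n.+1 => lebesgue_rVS (lebesgue_rV n)
  end.

End lebesgue_rV.
Arguments lebesgue_rV {R} n.

(* [lebesgue_rV n] is characterized by its values on boxes. *)
Lemma lebesgue_rV_box {R : realType} n (a b : 'rV[R]_n) :
  (forall i, a ord0 i <= b ord0 i) ->
  lebesgue_rV n
    [set x : 'rV[R]_n | forall i, x ord0 i \in `[a ord0 i, b ord0 i]] =
  (\prod_(i < n) (b ord0 i - a ord0 i))%:E.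
Proof.
elim: n a b => [|n IHn] a b ab.
  rewrite big_ord0 /= /dirac indicE mem_set//.
  by case.
pose a' : 'rV[R]_n := \row_i a ord0 (lift ord0 i).
pose b' : 'rV[R]_n := \row_i b ord0 (lift ord0 i).
transitivity ((@lebesgue_measure R \x lebesgue_rV n)%E
    (`[a ord0 ord0, b ord0 ord0]%classic `*`
     [set x : 'rV[R]_n | forall i, x ord0 i \in `[a' ord0 i, b' ord0 i]])).
  rewrite /= /lebesgue_rVS /pushforward; congr (_ _).
  apply/seteqP; split=> -[t x] /= => [H|[tab H] i].
    split; first by have := H ord0; rewrite mxE unlift_none.
    by move=> i; have := H (lift ord0 i); rewrite !mxE liftK.
  rewrite mxE; case: unliftP => [j|] ->//.
  by have := H j; rewrite !mxE.
rewrite product_measure1E//; last first.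
  rewrite (_ : [set x : 'rV[R]_n | _] = \bigcap_(i in [set: 'I_n])
      ((fun x : 'rV[R]_n => x ord0 i) @^-1` `[a' ord0 i, b' ord0 i])).
    apply: fin_bigcap_measurable => // i _; rewrite -[X in measurable X]setTI.
    exact: measurable_coord.
  by apply/seteqP; split => x /= H i; [move=> _|]; exact: H.
rewrite IHn => [|i]; last by rewrite !mxE.
rewrite big_ord_recl EFinM; congr (_ * _)%E.
  transitivity (@lebesgue_measure R `[a ord0 ord0, b ord0 ord0]%classic) => //.
  rewrite lebesgue_measure_itv/= lte_fin.
  by case: ltgtP (ab ord0) => // ->; rewrite subrr.
by congr EFin; apply: eq_bigr => i _; rewrite !mxE.
Qed.

Section bessel_capacity.
Context {R : realType} {n : nat}.
Implicit Types (f g G : 'rV[R]_n -> R) (x y xi : 'rV[R]_n).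
Implicit Types (E K A : set 'rV[R]_n) (s p q : R).

Local Notation mu := (lebesgue_rV n).

Definition dotr x y : R := \sum_(i < n) x ord0 i * y ord0 i.

(* The integral of f(x) exp(- i x.xi) dx; with this normalization the Fourier
   transform turns convolutions into products and G_alpha has mass 1. *)
Definition fourier f xi : R[i] :=
  (\int[mu]_x (f x * cos (dotr x xi)) -i*
   \int[mu]_x (f x * sin (dotr x xi)))%C.

(* For alpha <= n the inverse Fourier transform of (1 + |xi|^2)^(- alpha / 2) is
   not an absolutely convergent integral: G_alpha is the element of L^1 with this
   Fourier transform, and G is any of its representatives. The capacity below
   does not depend on this choice. *)
Definition is_bessel_kernel (alpha : R) G :=
  mu.-integrable setT (EFin \o G) /\
  forall xi, fourier G xi = ((1 + dotr xi xi) `^ (- (alpha / 2)))%:C%C.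

Definition convolution G f x : \bar R := (\int[mu]_y (G (x - y) * f y)%:E)%E.

Definition bessel_cap G s E : \bar R :=
  ereal_inf [set ('N[mu]_s%:E [EFin \o f] `^ s)%E | f in
    [set f : 'rV[R]_n -> R | [/\ measurable_fun setT f, forall x, 0 <= f x &
                 forall x, E x -> (1 <= convolution G f x)%E]]].

Definition M_norm G s p f : \bar R :=
  ereal_sup [set ((\int[mu]_(x in K) (`|f x| `^ p)%:E / bessel_cap G s K)
                    `^ p^-1)%E |
    K in [set K | compact K /\ bessel_cap G s K != 0%E]].

Definition M_space G s p : set ('rV[R]_n -> R) :=
  [set f : 'rV[R]_n -> R | [/\ measurable_fun setT f,
    forall K, compact K -> (\int[mu]_(x in K) (`|f x| `^ p)%:E < +oo)%E &
    (M_norm G s p f < +oo)%E]].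

Definition kothe_norm (X : set ('rV[R]_n -> R)) (N : ('rV[R]_n -> R) -> \bar R)
    f : \bar R :=
  ereal_sup [set (\int[mu]_x `|f x * g x|%:E)%E |
    g in [set g | X g /\ (N g <= 1)%E]].

Definition kothe_dual (X : set ('rV[R]_n -> R))
    (N : ('rV[R]_n -> R) -> \bar R) : set ('rV[R]_n -> R) :=
  [set f : 'rV[R]_n -> R | measurable_fun setT f /\ (kothe_norm X N f < +oo)%E].

(* When the capacity of A is 0, [`^] gives 0 instead of +oo on the right-hand
   side. This is harmless: A is then a null set, so a = 0 a.e. *)
Definition B_atom G s q (a : 'rV[R]_n -> R) :=
  a \in Lfun mu q%:E /\
  exists A, [/\ bounded_set A, {ae mu, forall x, ~ A x -> a x = 0} &
    ('N[mu]_q%:E [EFin \o a] <= bessel_cap G s A `^ ((1 - q) / q))%E].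

Definition B_representation G s q f (c : R^nat) (a : ('rV[R]_n -> R)^nat) :=
  [/\ (\sum_(0 <= j <oo) `|c j|%:E < +oo)%E,
      forall j, B_atom G s q (a j) &
      {ae mu, forall x, series (fun j => c j * a j x) @ \oo --> f x}].

Definition B_norm G s q f : \bar R :=
  ereal_inf [set (\sum_(0 <= j <oo) `|ca.1 j|%:E)%E |
    ca in [set ca | B_representation G s q f ca.1 ca.2]].

Definition B_space G s q : set ('rV[R]_n -> R) :=
  [set f : 'rV[R]_n -> R | measurable_fun setT f /\
    exists c a, B_representation G s q f c a].

End bessel_capacity.

(** Function spaces on R^n are given by a set [X] of functions and a norm [N],
    two functions being identified when they are equal a.e. *)
Section duality.
Context {R : realType} {n : nat}.
Implicit Types (X Y : set ('rV[R]_n -> R)) (N : ('rV[R]_n -> R) -> \bar R).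
Implicit Types (f g h : 'rV[R]_n -> R) (L : ('rV[R]_n -> R) -> R).

Local Notation mu := (lebesgue_rV n).

(* Only the values of [L] on [X] matter. Boundedness makes [L] compatible with
   a.e. equality. *)
Definition dual_space X N : set (('rV[R]_n -> R) -> R) :=
  [set L | (forall (k : R) f g, X f -> X g ->
              L (fun x => k * f x + g x) = k * L f + L g) /\
           exists C : R, forall f, X f -> (`|L f|%:E <= C%:E * N f)%E].

Definition dual_norm X N L : \bar R :=
  ereal_sup [set `|L f|%:E | f in [set f | X f /\ (N f <= 1)%E]].

Definition pairing g f : R := (\int[mu]_x (f x * g x))%R.

(* X^* = Y isometrically: [pairing] is a well-defined linear isometry from
   [(Y, NY)] onto the dual of [(X, NX)], injective up to a.e. equality. *)
Definition dual_isometric X NX Y NY :=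
  [/\ forall g f, Y g -> X f -> mu.-integrable setT (fun x => (f x * g x)%:E),
      forall (k : R) g h, Y g -> Y h -> Y (fun x => k * g x + h x) /\
        forall f, X f ->
          pairing (fun x => k * g x + h x) f = k * pairing g f + pairing h f,
      forall g, Y g ->
        dual_space X NX (pairing g) /\ dual_norm X NX (pairing g) = NY g,
      forall L, dual_space X NX L ->
        exists2 g, Y g & forall f, X f -> L f = pairing g f &
      forall g h, Y g -> Y h -> (forall f, X f -> pairing g f = pairing h f) ->
        g = h %[ae mu]].

End duality.

(* Main.v *)
(* Write q = p / (p - 1). Let X be either of the two candidate preduals of M. In
   both cases an L^q function f supported in a compact K has norm at most
   |f|_q Cap(K)^(1/p), elements g of M satisfy |int f g| <= |f|_X |g|_M, and
   compactly supported L^q functions are dense in X; this is all one needs for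
   X^* = M. A bounded functional L gives a countably additive set function
   A |-> L(1_A) on bounded sets, whose Radon-Nikodym density g represents L.
   Testing g against sgn(g) |g|^(p - 1) 1_K yields
   int_K |g|^p <= |L|^p Cap(K) for every compact K, that is, g is in M with norm
   at most |L|, and the same test functions show that g |-> int . g is isometric.

   For the block space the bound on the pairing comes from inner regularity, since
   blocks live on arbitrary bounded sets while the norm of M only sees compact
   ones, and density comes from partial sums. For the Koethe dual the issue is
   density: it follows from the p-convexity of M, which makes the dual norm
   absolutely continuous. The only properties of the Bessel capacity used are its
   monotonicity, its finiteness on bounded sets (as int G <> 0), and the fact that
   sets of zero capacity are Lebesgue null (a weak form of Young's inequality). *)

From HB Require Import structures.
Require Import Defs.
From mathcomp Require Import all_boot all_order all_algebra.
From mathcomp Require Import complex finmap.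
From mathcomp Require Import all_classical all_reals all_analysis.
From mathcomp Require Import measurable_realfun lra ring.

Set Implicit Arguments.
Unset Strict Implicit.
Unset Printing Implicit Defensive.

Import Order.TTheory GRing.Theory Num.Theory.
Import numFieldNormedType.Exports.

Local Open Scope classical_set_scope.
Local Open Scope ring_scope.

(** * Lebesgue measure on R^n *)

Section reflection.
Context {R : realType}.
Local Open Scope ereal_scope.

(** Representing L runs into a circularity: the natural test function sgn(g) |g|^(p - 1) is known to
    lie in L^q(K) only once g lies in L^p(K), which is the conclusion sought. It is broken by
    testing on the part of K where |g| <= k, with a bound that does not depend on k. For the same
    reason the formula L f = int f g is proved for L^q functions of bounded support under the
    assumption that f g is integrable; the assumption is removed once g is placed in M.

    The gain from p-convexity is a mismatch of powers of t. Replacing g by (1 - t^p) g on A costs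
    t^p times the norm of f, while t g1 becomes available outside A. So the mass of f g1 there is at
    most t^(p - 1) times the norm of f, plus the error of g divided by t. The first term is small
    with t because p > 1, and the error is chosen after t.

    The definition of the kernel gives no pointwise sign, so both capacity estimates go through
    |G|. *)

Lemma measurable_fun_reflection n (a : 'rV[R]_n) :
  measurable_fun [set: 'rV[R]_n] (fun x => a - x)%R.
Proof.
apply/measurable_fun_rVP => i; under eq_fun do rewrite !mxE.
by apply: measurable_funB => //; exact: measurable_coord.
Qed.

Lemma ge0_integral_reflection1 (a : R) (f : measurableTypeR R -> \bar R) :
  measurable_fun setT f -> (forall x, 0 <= f x) ->
  \int[lebesgue_measure]_x f (a - x)%R = \int[lebesgue_measure]_x f x.
Proof.
move=> mf f0.
have mphi : measurable_fun [set: measurableTypeR R]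
    ((fun x => a - x)%R : measurableTypeR R -> measurableTypeR R).
  by apply: measurable_funB => //; exact: measurable_id.
transitivity (\int[pushforward (@lebesgue_measure R)
    ((fun x => a - x)%R : measurableTypeR R -> measurableTypeR R)]_x f x).
  by rewrite ge0_integral_pushforward.
apply: eq_measure_integral => A mA _; apply/esym/lebesgue_measure_unique => //.
move=> _ [[c d]] _ <-; rewrite /= /pushforward.
(* Reflection exchanges the open and the closed end of the generating interval, which does not
   affect its length. *)
rewrite (_ : _ @^-1` _ = `[a - d, a - c[%classic)%R; last first.
  apply/seteqP; split=> x /=; rewrite !in_itv /= => /andP[? ?]; apply/andP; split; lra.
rewrite !lebesgue_measure_itv/= !lte_fin.
have -> : (a - d < a - c)%R = (c < d)%R by rewrite ltrD2l ltrN2.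
by case: ifPn => // _; rewrite -!EFinB; congr EFin; ring.
Qed.

(** Induction on the dimension: Tonelli splits off the first coordinate, and the reflection acts on
    each factor separately. *)
Lemma ge0_integral_reflection n (a : 'rV[R]_n) (f : 'rV[R]_n -> \bar R) :
  measurable_fun setT f -> (forall x, 0 <= f x) ->
  \int[lebesgue_rV n]_x f (a - x)%R = \int[lebesgue_rV n]_x f x.
Proof.
elim: n a f => [|n IHn] a f mf f0.
  by apply: eq_integral => x _; congr f; apply/rowP; case.
have mfr : measurable_fun setT (fun x : 'rV[R]_n.+1 => f (a - x)%R).
  exact: (measurableT_comp mf (measurable_fun_reflection a)).
have step (g : 'rV[R]_n.+1 -> \bar R) : measurable_fun setT g ->
    (forall x, 0 <= g x) -> \int[lebesgue_rV n.+1]_x g x =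
    \int[lebesgue_measure]_t \int[lebesgue_rV n]_y g (rV_cons (t, y)).
  move=> mg g0.
  rewrite /= ge0_integral_pushforward//; last exact: measurable_rV_cons.
  rewrite preimage_setT fubini_tonelli1//; last by move=> x /=.
  by apply: (measurableT_comp mg); exact: measurable_rV_cons.
rewrite (step _ mf f0) (step _ mfr (fun x => f0 _)).
pose a0 : R := a ord0 ord0; pose a' : 'rV[R]_n := \row_i a ord0 (lift ord0 i).
have consB t y : (a - rV_cons (t, y) = rV_cons ((a0 - t)%R : measurableTypeR R, a' - y))%R.
  apply/rowP => i; rewrite !mxE; case: unliftP => [j ->|->] //=.
  by rewrite !mxE.
under eq_integral => t _.
  under eq_integral do rewrite consB.
  rewrite (IHn a' (fun y => f (rV_cons ((a0 - t)%R : measurableTypeR R, y))))//; last first.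
    apply: (measurableT_comp mf); apply: (measurableT_comp (@measurable_rV_cons R n)).
    exact: measurable_pair1.
  over.
rewrite (@ge0_integral_reflection1 a0 (fun t => \int[lebesgue_rV n]_y f (rV_cons (t, y))))//.
  apply: (@measurable_fun_fubini_tonelli_F _ _ _ _ _ (lebesgue_rV n) (f \o @rV_cons R n)) => [|x]; last exact: f0.
  by apply: (measurableT_comp mf); exact: measurable_rV_cons.
by move=> t; apply: integral_ge0 => y _.
Qed.

(** Applied to a convolution, this exchanges the roles of the kernel and the function. *)
Lemma integral_reflection n (a : 'rV[R]_n) (f : 'rV[R]_n -> \bar R) :
  measurable_fun setT f ->
  \int[lebesgue_rV n]_x f (a - x)%R = \int[lebesgue_rV n]_x f x.
Proof.
move=> mf; rewrite integralE [RHS]integralE.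
rewrite -(@ge0_integral_reflection n a f^\+)//; last exact: measurable_funepos.
rewrite -(@ge0_integral_reflection n a f^\-)//; [|exact: measurable_funeneg].
by congr (_ - _); apply: eq_integral => x _; rewrite ?funeposE ?funenegE.
Qed.

End reflection.

(** * Regularity of Borel measures on R^n *)

Section regularity.
Context {R : realType} {n : nat}.
Local Notation V := 'rV[R]_n.
Local Open Scope ereal_scope.

Lemma closed_measurable_rV (F : set V) : closed F -> measurable F.
Proof.
move=> cF; rewrite -(setCK F); apply: measurableC; apply: open_measurable_rV.
by rewrite openC.
Qed.

Lemma compact_closed_rV (K : set V) : compact K -> closed K.
Proof. by apply: compact_closed; exact: norm_hausdorff. Qed.

Lemma compact_measurable_rV (K : set V) : compact K -> measurable K.
Proof. by move/compact_closed_rV; exact: closed_measurable_rV. Qed.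

Definition cball (r : R) : set V := [set x | (`|x| <= r)%R].

Lemma compact_cball r : compact (cball r).
Proof.
apply: bounded_closed_compact.
  by exists r; split => [|M rM x /= xr]; [exact: num_real|exact: le_trans xr (ltW rM)].
rewrite (_ : cball r = (fun x : V => `|x|%R) @^-1` [set t | (t <= r)%R])//.
apply: closed_comp; last exact: closed_le.
by move=> x _; exact: norm_continuous.
Qed.

Lemma measurable_cball r : measurable (cball r).
Proof. by apply: compact_measurable_rV; exact: compact_cball. Qed.

Lemma bounded_subset_cball (A : set V) : bounded_set A ->
  exists r, (0 < r)%R /\ A `<=` cball r.
Proof.
move=> [M [Mr MA]]; exists (Num.max (M + 1) 1)%R; split.
  by rewrite lt_max ltr01 orbT.
by move=> x /MA; apply; rewrite lt_max ltrDl ltr01.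
Qed.

Lemma compact_subset_cball (K : set V) : compact K ->
  exists r, (0 < r)%R /\ K `<=` cball r.
Proof. by move/compact_bounded/bounded_subset_cball. Qed.

Lemma open_bigcup_closed (U : set V) : open U ->
  exists F : (set V)^nat, [/\ forall k, closed (F k),
    nondecreasing_seq F & \bigcup_k F k = U].
Proof.
move=> oU.
(* The points at distance at least 1/(k + 1) from the complement of [U]. *)
pose F k : set V := ~` \bigcup_(y in ~` U) ball y k.+1%:R^-1.
exists F; split.
- move=> k; apply: open_closedC; apply: bigcup_open => y _.
  exact: ball_open.
- move=> k l kl; apply/subsetPset => x /= Fx [y Uy xy]; apply: Fx.
  exists y => //; apply: le_ball xy.
  by rewrite lef_pV2 ?posrE// ler_nat ltnS.
- apply/seteqP; split=> [x [k _ Fx]|x Ux].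
    by apply: contrapT => Ux; apply: Fx; exists x => //; apply: ballxx; rewrite invr_gt0.
  have /nbhs_ballP[e /= e0 xeU] : nbhs x U by exact: open_nbhs_nbhs.
  have [k _ /(_ k (leqnn k)) /= ke] := near_infty_natSinv_lt (PosNum e0).
  exists k => // -[y Uy xy]; apply: Uy; apply: xeU; apply: ball_sym.
  exact: le_ball (ltW ke) _ xy.
Qed.

Variable mu : {measure set V -> \bar R}.

(** Approximating from both sides makes the property pass to complements. The error is measured
    inside [B], of finite measure in the applications, so that continuity from above applies even
    when [mu] is infinite. *)
Definition regular_set (B A : set V) := forall e : R, (0 < e)%R ->
  exists F U, [/\ closed F, open U, F `<=` A, A `<=` U &
    mu (B `&` (U `\` F)) <= e%:E].

Lemma regular_open B A : measurable B -> mu B < +oo -> open A -> regular_set B A.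
Proof.
move=> mB Boo oA e e0; have [F [cF ndF FA]] := open_bigcup_closed oA.
pose G k := B `&` (A `\` F k).
have mG k : measurable (G k).
  by apply: measurableI => //; apply: measurableD;
    [exact: open_measurable_rV|exact: closed_measurable_rV].
have G0 : \bigcap_k G k = set0.
  rewrite -subset0 => x Gx; have [_ [Ax _]] := Gx 0%N I.
  by move: Ax; rewrite -FA => -[k _ Fk]; have [_ [_]] := Gx k I.
have := @nonincreasing_cvg_mu _ _ _ mu G.
rewrite G0 measure0 => /(_ _ _ measurable0) H.
have {}H : (mu \o G) k @[k --> \oo] --> 0.
  apply: H => //.
    by apply: le_lt_trans Boo; apply: le_measure; rewrite ?inE//; exact: subIsetl.
  move=> k l kl; apply/subsetPset; apply: setIS; apply: setDS.
  exact/subsetPset/ndF.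
have /fine_cvgP[Gfin /cvgrPdist_lt/(_ e e0) Ge] := H.
have [N _ NG] : \forall k \near \oo, (mu (G k) \is a fin_num) /\ (`|0 - fine (mu (G k))| < e)%R.
  by near=> k; split; near: k.
have [fG Gle] := NG N (leqnn N).
exists (F N), A; split => //; first by move=> x Fx; rewrite -FA; exists N.
rewrite -(fineK fG) lee_fin; move: Gle; rewrite sub0r normrN => /ltW; apply: le_trans.
exact: ler_norm.
Unshelve. all: by end_near. Qed.

(** A countable union of closed sets need not be closed, so only finitely many of the inner sets are
    kept. Half of [e] pays for the sum of the individual errors, the other half, by continuity from
    above on [B], for the closed sets that are dropped. *)
Lemma regular_bigcup B (A : (set V)^nat) : measurable B -> mu B < +oo ->
  (forall k, regular_set B (A k)) -> regular_set B (\bigcup_k A k).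
Proof.
move=> mB Boo rA e e0.
have e2 : (0 < e / 2)%R by rewrite divr_gt0.
have ek k : (0 < (e / 2) / (2 ^ k.+1)%:R)%R.
  by rewrite divr_gt0// ltr0n expn_gt0.
have /choice[FU FUP] : forall k, exists FU : set V * set V,
    [/\ closed FU.1, open FU.2, FU.1 `<=` A k, A k `<=` FU.2 &
    mu (B `&` (FU.2 `\` FU.1)) <= ((e / 2) / (2 ^ k.+1)%:R)%:E].
  by move=> k; have [F [U H]] := rA k _ (ek k); exists (F, U).
pose F k := (FU k).1; pose U k := (FU k).2.
pose O := \bigcup_k U k.
have oO : open O by apply: bigcup_open => k _; have [] := FUP k.
have mF k : measurable (F k) by apply: closed_measurable_rV; have [] := FUP k.
have mU k : measurable (U k) by apply: open_measurable_rV; have [] := FUP k.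
pose H k := \big[setU/set0]_(i < k) F i.
have mH k : measurable (H k) by exact: bigsetU_measurable.
pose G k := B `&` (O `\` H k).
have mO : measurable O by exact: open_measurable_rV.
have mG k : measurable (G k) by apply: measurableI => //; exact: measurableD.
have GE : \bigcap_k G k = B `&` (O `\` \bigcup_k F k).
  apply/seteqP; split => [x Gx|x [Bx [Ox nF]] k _].
    have [Bx [Ox _]] := Gx 0%N I; split=> //; split => // -[k _ Fk].
    have [_ [_ ]] := Gx k.+1 I; apply; rewrite /H big_ord_recr /=; right.
    exact: Fk.
  split=> //; split => //; rewrite /H -bigcup_mkord => -[i _ Fi].
  by apply: nF; exists i.
have Gle : mu (\bigcap_k G k) <= (e / 2)%:E.
  rewrite GE; apply: (@le_trans _ _ (\sum_(0 <= k <oo) mu (B `&` (U k `\` F k)))).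
    apply: measure_sigma_subadditive.
    - by move=> k; apply: measurableI => //; exact: measurableD.
    - apply: measurableI => //; apply: measurableD => //.
      by apply: bigcup_measurable => k _; exact: mF.
    - move=> x [Bx [[k _ Uk] nF]]; exists k => //; split=> //; split => // Fk.
      by apply: nF; exists k.
  have := @epsilon_trick R (fun=> 0) (e / 2)%R xpredT (fun=> lexx _) (ltW e2).
  rewrite [X in _ <= X + _]eseries0// add0e; apply: le_trans.
  apply: lee_nneseries => [k _ _|k _]; first exact: measure_ge0.
  by rewrite add0e; have [] := FUP k.
have cG : (mu \o G) k @[k --> \oo] --> mu (\bigcap_k G k).
  apply: nonincreasing_cvg_mu => //.
  - by apply: le_lt_trans Boo; apply: le_measure; rewrite ?inE//; exact: subIsetl.
  - exact: bigcap_measurable.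
  - move=> k l kl; apply/subsetPset; apply: setIS; apply: setDS.
    by apply: subset_bigsetU.
have fG : mu (\bigcap_k G k) \is a fin_num.
  by rewrite ge0_fin_numE ?measure_ge0// (le_lt_trans Gle)// ltry.
have [N NG] : exists N, mu (G N) <= e%:E.
  move: cG; rewrite -(fineK fG) => /fine_cvgP[Gfin /cvgrPdist_lt/(_ _ e2) Ge].
  have [N _ NG] : \forall k \near \oo, (mu (G k) \is a fin_num) /\
    (`|fine (mu (\bigcap_k G k)) - fine (mu (G k))| < e / 2)%R.
    by near=> k; split; near: k.
  have [fGN p] := NG N (leqnn N); exists N; rewrite -(fineK fGN) lee_fin.
  have : (fine (mu (\bigcap_k G k)) <= e / 2)%R by rewrite -lee_fin fineK.
  move: p; rewrite ltr_norml => /andP[]; lra.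
exists (H N), O; split => //.
- by rewrite /H; apply: closed_bigsetU => i _; have [] := FUP i.
- rewrite /H -bigcup_mkord => x [k _ Fk]; exists k => //.
  by have [_ _ + _ _] := FUP k; apply.
- by move=> x [k _ Ak]; exists k => //; have [_ _ _ + _] := FUP k; apply.
Unshelve. all: by end_near. Qed.

Lemma regular_measurable B A : measurable B -> mu B < +oo ->
  measurable A -> regular_set B A.
Proof.
move=> mB Boo; apply: (@smallest_sub _ (sigma_algebra setT) open (regular_set B)).
  split.
  - by apply: regular_open => //; exact: open0.
  - move=> C rC e e0; have [F [U [cF oU FC CU le]]] := rC e e0.
    exists (~` U), (~` F); split => //.
    + exact: open_closedC.
    + exact: closed_openC.
    + by rewrite setTD; exact: subsetC.
    + by rewrite setTD; exact: subsetC.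
    + rewrite (_ : B `&` _ = B `&` (U `\` F))//.
      apply/seteqP; split=> x [Bx [h1 h2]]; split => //; split => //.
      exact: contrapT.
  - by move=> C rC; exact: regular_bigcup.
by move=> C oC; exact: regular_open.
Qed.

Lemma inner_regular (S : set V) r (e : R) : mu (cball r) < +oo ->
  measurable S -> S `<=` cball r -> (0 < e)%R ->
  exists K, [/\ compact K, K `<=` S & mu (S `\` K) <= e%:E].
Proof.
move=> roo mS Sr e0.
have [F [U [cF oU FS SU le]]] := regular_measurable (measurable_cball r) roo mS e0.
exists F; split => //.
  exact: (subclosed_compact cF (@compact_cball r) (subset_trans FS Sr)).
apply: le_trans le; apply: le_measure; rewrite ?inE.
- by apply: measurableD => //; exact: closed_measurable_rV.
- apply: measurableI; first exact: measurable_cball.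
  by apply: measurableD; [exact: open_measurable_rV|exact: closed_measurable_rV].
- by move=> x [Sx nF]; split; [exact: Sr|split => //; exact: SU].
Qed.

End regularity.

Lemma measurable_box_rV {R : realType} n (a b : 'rV[R]_n) :
  measurable [set x : 'rV[R]_n | forall i, x ord0 i \in `[a ord0 i, b ord0 i]].
Proof.
rewrite (_ : [set x : 'rV[R]_n | _] = \bigcap_(i in [set: 'I_n])
  ((fun x : 'rV[R]_n => x ord0 i) @^-1` `[a ord0 i, b ord0 i])).
  apply: fin_bigcap_measurable => // i _; rewrite -[X in measurable X]setTI.
  exact: measurable_coord.
by apply/seteqP; split => x /= H i; [move=> _|]; exact: H.
Qed.

(** The norm on row vectors is the sup norm, so the ball lies in a box of side 2|r|; the absolute
    value covers negative radii. *)
Lemma lebesgue_rV_cball_lty {R : realType} n (r : R) :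
  (lebesgue_rV n (@cball R n r) < +oo)%E.
Proof.
pose b : 'rV[R]_n := const_mx `|r|.
apply: (@le_lt_trans _ _ (lebesgue_rV n
  [set x : 'rV[R]_n | forall i, x ord0 i \in `[(- b) ord0 i, b ord0 i]])).
  apply: le_measure; rewrite ?inE; first exact: measurable_cball.
    exact: measurable_box_rV.
  move=> x /= xr i; rewrite !mxE in_itv /= -ler_norml.
  apply: (@le_trans _ _ `|x|); last by rewrite (le_trans xr)// ler_norm.
  by rewrite [leRHS]/Num.norm /= mx_normrE; exact: (le_bigmax _ (fun ij => `|x ij.1 ij.2|) (ord0, i)).
rewrite lebesgue_rV_box ?ltry// => i; rewrite !mxE.
by rewrite (@le_trans _ _ 0)// oppr_le0.
Qed.

(** * Bessel capacity *)

Section capacity.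
Context {R : realType} {n : nat}.
Local Notation V := 'rV[R]_n.
Local Notation mu := (lebesgue_rV n).
Local Open Scope ereal_scope.
Implicit Types (G f : V -> R) (s : R) (E : set V).

Lemma bessel_cap_ge0 G s E : 0 <= bessel_cap G s E.
Proof. by apply: le_ereal_inf_tmp => _ [f _ <-]; exact: poweR_ge0. Qed.

Lemma le_bessel_cap G s E E' : E `<=` E' -> bessel_cap G s E <= bessel_cap G s E'.
Proof.
move=> EE'; apply: ereal_inf_le_tmp => _ [f [mf f0 f1] <-].
by exists f => //; split => // x /EE'; exact: f1.
Qed.

(** At the origin the real part of [fourier] is the integral of [G], and the prescribed value is a
    power of 1. *)
Lemma integral_fourier_bessel alpha G : is_bessel_kernel alpha G ->
  \int[mu]_x (G x)%:E = 1.
Proof.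
move=> [iG /(_ 0%R)] [] + _.
have d0 (x : V) : dotr x 0 = 0%R.
  by rewrite /dotr big1// => i _; rewrite mxE mulr0.
rewrite d0 addr0 powR1.
under eq_Rintegral do rewrite d0 cos0 mulr1.
move=> H; rewrite -[LHS]fineK ?integrable_fin_num//.
by rewrite -[X in X%:E]/(\int[mu]_x (G x))%R H.
Qed.

Lemma measurable_fun_shiftr (x : V) (f : V -> R) : measurable_fun setT f ->
  measurable_fun setT (fun y : V => f (x - y)%R).
Proof. by move=> mf; exact: (measurableT_comp mf (measurable_fun_reflection x)). Qed.

Lemma measurable_fun_diff2 (f : V -> R) : measurable_fun setT f ->
  measurable_fun setT (fun xy : V * V => f (xy.1 - xy.2)%R).
Proof.
move=> mf; apply: (measurableT_comp mf (g := fun xy : V * V => (xy.1 - xy.2)%R)).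
apply/measurable_fun_rVP => i; under eq_fun do rewrite !mxE.
by apply: measurable_funB; apply: (measurableT_comp (measurable_coord i));
  [exact: measurable_fst|exact: measurable_snd].
Qed.

Lemma ge0_integral_shift (a : V) (f : V -> \bar R) :
  measurable_fun setT f -> (forall x, 0 <= f x) ->
  \int[mu]_x f (x - a)%R = \int[mu]_x f x.
Proof.
move=> mf f0.
rewrite -(ge0_integral_reflection 0 mf f0).
rewrite -(@ge0_integral_reflection _ _ a (fun z => f (0 - z)%R))//.
  by apply: eq_integral => x _; rewrite sub0r opprB.
exact: (measurableT_comp mf (measurable_fun_reflection _)).
Qed.

Lemma bigcup_cball : \bigcup_k (@cball R n k%:R) = setT.
Proof.
rewrite -subTset => x _; exists (Num.truncn `|x|%R).+1 => //=.
by rewrite /cball /= ltW// truncnS_gt.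
Qed.

Lemma nondecreasing_cball : nondecreasing_seq (fun k : nat => @cball R n k%:R).
Proof.
move=> k l kl; apply/subsetPset => x; rewrite /cball /= => /le_trans; apply.
by rewrite ler_nat.
Qed.

Lemma integral_tail_cball (h : V -> \bar R) (e : R) : measurable_fun setT h ->
  (forall x, 0 <= h x) -> \int[mu]_x h x < +oo -> (0 < e)%R ->
  exists N : nat, \int[mu]_(x in ~` cball N%:R) h x <= e%:E.
Proof.
move=> mh h0 hoo e0.
have c : \int[mu]_(x in cball k%:R) h x @[k --> \oo] --> \int[mu]_x h x.
  rewrite -bigcup_cball; apply: ge0_nondecreasing_set_cvg_integral => //.
  - exact: nondecreasing_cball.
  - by move=> k; exact: measurable_cball.
  - by move=> k; exact: measurable_funTS.
have fI : \int[mu]_x h x \is a fin_num by rewrite ge0_fin_numE ?integral_ge0.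
move: c; rewrite -(fineK fI) => /fine_cvgP[Gfin /cvgrPdist_lt/(_ _ e0) Ge].
have [N _ /(_ N (leqnn N))[fN HN]] : \forall k \near \oo,
    (\int[mu]_(x in cball k%:R) h x \is a fin_num) /\
    (`|fine (\int[mu]_x h x) - fine (\int[mu]_(x in cball k%:R) h x)| < e)%R.
  by near=> k; split; near: k.
exists N.
have : \int[mu]_x h x =
    \int[mu]_(x in cball N%:R) h x + \int[mu]_(x in ~` cball N%:R) h x.
  rewrite -ge0_integral_setU ?setUv//; first exact: measurable_cball.
    by apply: measurableC; exact: measurable_cball.
  by apply/disj_setPS; rewrite setICr.
move: HN; rewrite -(fineK fN) -(fineK fI) /=.
have : 0 <= \int[mu]_(x in ~` cball N%:R) h x by exact: integral_ge0.
case: (\int[mu]_(x in ~` cball N%:R) h x) => [t| |]//=.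
rewrite -EFinD !lee_fin => t0 ltIe [IE]; move: ltIe.
by rewrite IE addrC addKr ger0_norm// => /ltW.
Unshelve. all: by end_near. Qed.

(** Twice the indicator of a large ball is a test function: [G] has integral 1, and a region
    carrying all but 1/2 of the mass of |G| retains at least 1/2 of this integral. *)
Lemma bessel_cap_lty G s E : (0 < s)%R -> mu.-integrable setT (EFin \o G) ->
  \int[mu]_x (G x)%:E = 1 -> bounded_set E -> bessel_cap G s E < +oo.
Proof.
move=> s0 iG G1 /bounded_subset_cball[r [r0 Er]].
have mG : measurable_fun setT G by exact/measurable_EFinP/measurable_int/iG.
have maG : measurable_fun setT (fun x => `|G x|%:E).
  by apply/measurable_EFinP; exact: measurableT_comp.
have aGoo : \int[mu]_x `|G x|%:E < +oo by have /integrableP[] := iG.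
have [||N HN] := @integral_tail_cball (fun x => `|G x|%:E) 2^-1 maG _ aGoo.
- by move=> x; rewrite lee_fin.
- by rewrite invr_gt0.
(* For every x in [E] the reflected ball of radius [rho] about x contains the ball of radius [N]
   about 0, outside which |G| has mass at most 1/2. *)
pose rho := (N%:R + r)%R.
pose f : V -> R := fun x => (2 * \1_(cball rho) x)%R.
have mf : measurable_fun setT f.
  by apply: measurable_funM => //; apply: measurable_indic; exact: measurable_cball.
have f0 x : (0 <= f x)%R by rewrite mulr_ge0// indicE.
apply: (@le_lt_trans _ _ ('N[mu]_s%:E [EFin \o f] `^ s)); last first.
  rewrite powR_Lnorm ?gt_eqF//.
  apply: (@le_lt_trans _ _ (\int[mu]_x ((2 `^ s)%:E * (\1_(cball rho) x)%:E))).
    apply: ge0_le_integral => //.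
    - by move=> x _; exact: poweR_ge0.
    - apply: (measurableT_comp (measurable_poweR s)).
      by apply: measurableT_comp => //; exact/measurable_EFinP.
    - apply: emeasurable_funM => //; apply/measurable_EFinP.
      by apply: measurable_indic; exact: measurable_cball.
    - move=> x _; rewrite /= /f indicE; case: (x \in _) => /=; first by rewrite mulr1 mule1 ger0_norm.
      by rewrite mulr0 mule0 normr0 powR0// gt_eqF.
  rewrite ge0_integralZl//.
  - rewrite integral_indic// ?setIT; last exact: measurable_cball.
    by rewrite lte_mul_pinfty ?lee_fin ?powR_ge0//; exact: lebesgue_rV_cball_lty.
  - apply/measurable_EFinP.
    by apply: measurable_indic; exact: measurable_cball.
apply: ereal_inf_lbound; exists f => //; split => // x Ex.
rewrite /convolution.
have -> : \int[mu]_y (G (x - y)%R * f y)%:E = \int[mu]_y (G y * f (x - y)%R)%:E.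
  rewrite -(@integral_reflection _ _ x (fun y => (G y * f (x - y)%R)%:E)).
    by apply: eq_integral => y _; rewrite subKr.
  by apply/measurable_EFinP; apply: measurable_funM => //; exact: measurable_fun_shiftr.
pose D : set V := [set y | cball rho (x - y)%R].
have mD : measurable D.
  rewrite -[X in measurable X]setTI; apply: (measurable_fun_reflection x) => //.
  exact: measurable_cball.
have iGD : mu.-integrable D (EFin \o G) by exact: integrableS iG.
have iGDC : mu.-integrable (~` D) (EFin \o G).
  by apply: integrableS iG => //; exact: measurableC.
have -> : \int[mu]_y (G y * f (x - y)%R)%:E = 2%:E * \int[mu]_(y in D) (G y)%:E.
  rewrite -integralZl// [RHS]integral_mkcond; apply: eq_integral => y _.
  rewrite patchE /f indicE mulrCA EFinM.
  have -> : ((x - y)%R \in cball rho) = (y \in D) by apply/idP/idP; rewrite !inE.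
  by case: ifPn => _; rewrite ?mulr1// mulr0 mule0.
have DC : \int[mu]_(y in ~` D) `|G y|%:E <= 2^-1%:E.
  apply: le_trans HN; apply: ge0_subset_integral => //.
  - exact: measurableC.
  - by apply: measurableC; exact: measurable_cball.
  - exact: measurable_funTS.
  - apply: subsetC => y /= yN; rewrite /D /cball /= /rho [leRHS]addrC.
    by rewrite (le_trans (ler_normB _ _))// lerD//; exact: Er.
have /le_trans/(_ DC) := @le_abse_integral _ _ _ mu (~` D) (EFin \o G) (measurableC mD) (measurable_int _ iGDC).
move: G1; rewrite -(setUv D) integral_setU//; last 3 first.
- exact: measurableC.
- by rewrite setUv; exact: measurable_int iG.
- by apply/disj_setPS; rewrite setICr.
rewrite /= -(fineK (integrable_fin_num mD iGD)) -(fineK (integrable_fin_num (measurableC mD) iGDC)) /=.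
move: (fine _) (fine _) => a b [ab]; rewrite lee_fin ler_norml => /andP[_ b2].
rewrite -EFinM lee_fin; lra.
Qed.

(** The convolution inequality is replaced by the pointwise bound t <= d + d^(1 - s) t^s for t >= 0.
    For a test function f it gives 1 <= d |G|_1 + c (|G| conv f^s) on [K], with c = d^(1 - s). The
    first term is at most 1/2, so by Tonelli half the measure of [K] is at most c |G|_1 times the
    integral of f^s, which is arbitrarily small when the capacity is 0. *)
Lemma bessel_cap_eq0 G s K : (1 < s)%R -> mu.-integrable setT (EFin \o G) ->
  measurable K -> bessel_cap G s K = 0 -> mu K = 0.
Proof.
move=> s1 iG mK capK.
have s0 : (0 < s)%R by exact: lt_trans s1.
have mG : measurable_fun setT G by exact/measurable_EFinP/measurable_int/iG.
pose aG : V -> R := fun x => `|G x|%R.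
have maG : measurable_fun setT aG by exact: measurableT_comp.
have aG0 x : (0 <= aG x)%R by exact: normr_ge0.
have aGoo : \int[mu]_x (aG x)%:E < +oo by have /integrableP[] := iG.
pose g := fine (\int[mu]_x (aG x)%:E).
have gE : \int[mu]_x (aG x)%:E = g%:E.
  by rewrite fineK// ge0_fin_numE// integral_ge0// => x _; rewrite lee_fin.
have g0 : (0 <= g)%R.
  by rewrite -lee_fin -gE integral_ge0// => x _; rewrite lee_fin.
(* Makes d g at most 1/2; adding 1 to [g] keeps the denominator positive. *)
pose d := (2 * (g + 1))^-1%R.
have d0 : (0 < d)%R by rewrite invr_gt0 mulr_gt0// ltr_wpDl.
pose c := (d `^ (1 - s))%R.
have c0 : (0 <= c)%R by exact: powR_ge0.
have young (t : R) : (0 <= t)%R -> (t <= d + c * t `^ s)%R.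
  move=> t0; have [td|dt] := leP t d.
    by rewrite (le_trans td)// lerDl mulr_ge0// powR_ge0.
  have t0' : (0 < t)%R by exact: lt_trans dt.
  apply: (@le_trans _ _ (c * t `^ s)%R); last by rewrite lerDr ltW.
  rewrite -{1}(powRr1 t0) -{1}(subrK s 1%R) powRD; last by apply/implyP => _; rewrite gt_eqF.
  rewrite ler_wpM2r ?powR_ge0// /c.
  rewrite -(opprB s 1%R) !powRN lef_pV2 ?posrE ?powR_gt0//.
  by rewrite ge0_ler_powR ?nnegrE ?subr_ge0 ?ltW.
have bound (e : R) : (0 < e)%R -> (2^-1)%:E * mu K <= (c * g * e)%:E.
  move=> e0.
  have : bessel_cap G s K < e%:E by rewrite capK lte_fin.
  move=> /ereal_inf_lt[_ [f [mf f0 f1] <-]]; rewrite powR_Lnorm ?gt_eqF// => fe.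
  pose F y := (f y `^ s)%R.
  have mF : measurable_fun setT F by exact: (measurableT_comp (measurable_powR s)).
  have F0 y : (0 <= F y)%R by exact: powR_ge0.
  have FE : \int[mu]_y (F y)%:E < e%:E.
    by under eq_integral do rewrite /F -(ger0_norm (f0 _)) -poweR_EFin -abse_EFin.
  pose H (xy : V * V) := (aG (xy.1 - xy.2)%R * F xy.2)%:E.
  have mH : measurable_fun setT H.
    apply/measurable_EFinP; apply: measurable_funM; first exact: measurable_fun_diff2.
    exact: (measurableT_comp mF measurable_snd).
  have H0 xy : 0 <= H xy by rewrite lee_fin mulr_ge0.
  pose Phi (x : V) : \bar R := \int[mu]_y H (x, y).
  have mPhi : measurable_fun setT Phi.
    exact: (@measurable_fun_fubini_tonelli_F _ _ _ _ _ mu H).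
  have Phi0 x : 0 <= Phi x by exact: integral_ge0.
  have mH1 x : measurable_fun setT (fun y => H (x, y)) by exact: (measurableT_comp mH (measurable_pair1 x)).
  have Phi1 x : K x -> 2^-1%:E <= c%:E * Phi x.
    move=> /f1; rewrite /convolution.
    have mGf : measurable_fun setT (fun y : V => (G (x - y)%R * f y)%:E).
      apply/measurable_EFinP; apply: measurable_funM => //; exact: measurable_fun_shiftr.
    have mA : measurable_fun setT (fun y : V => (aG (x - y)%R)%:E).
      by apply/measurable_EFinP; exact: measurable_fun_shiftr.
    have H1 : \int[mu]_y (G (x - y)%R * f y)%:E <=
        \int[mu]_y (d%:E * (aG (x - y)%R)%:E + c%:E * H (x, y)).
      apply: (le_trans (lee_abs _)); apply: (le_trans (le_abse_integral _ _ _)) => //.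
      apply: ge0_le_integral => //.
      - exact: measurableT_comp.
      - by apply: emeasurable_funD; apply: emeasurable_funM.
      - move=> y _; rewrite abse_EFin -!EFinM -EFinD lee_fin normrM (ger0_norm (f0 y)).
        apply: (le_trans (ler_wpM2l (normr_ge0 _) (young _ (f0 y)))).
        by rewrite /aG /F /= le_eqVlt; apply/orP; left; apply/eqP; ring.
    have H2 : \int[mu]_y (d%:E * (aG (x - y)%R)%:E + c%:E * H (x, y)) = (d * g)%:E + c%:E * Phi x.
      rewrite ge0_integralD//=; last 4 first.
      - by move=> y _; rewrite -EFinM lee_fin mulr_ge0// ltW.
      - exact: emeasurable_funM.
      - by move=> y _; rewrite mule_ge0.
      - exact: emeasurable_funM.
      rewrite ge0_integralZl//=; last 2 first.
      - by move=> y _; rewrite lee_fin.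
      - by rewrite lee_fin ltW.
      rewrite ge0_integralZl// (@ge0_integral_reflection _ _ x (fun y => (aG y)%:E)) ?gE//.
      - exact/measurable_EFinP.
    move=> /le_trans/(_ H1); rewrite H2.
    have dg : (d * g <= 2^-1)%R.
      rewrite /d invfM -mulrA ler_piMr ?invr_ge0//.
      by rewrite mulrC ler_pdivrMr ?ltr_wpDl// mul1r lerDl.
    case: (c%:E * Phi x) => [t| |]//=; last by move=> _; rewrite leey.
    by rewrite -EFinD !lee_fin; lra.
  apply: (@le_trans _ _ (\int[mu]_x (c%:E * Phi x))).
    apply: (@le_trans _ _ (\int[mu]_(x in K) (c%:E * Phi x))); last first.
      apply: ge0_subset_integral => //; first exact: emeasurable_funM.
      by move=> x _; rewrite mule_ge0.
    rewrite -integral_cst//; apply: ge0_le_integral => //.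
    - by move=> x _; rewrite lee_fin invr_ge0.
    - by apply: measurable_funTS; exact: emeasurable_funM.
  rewrite ge0_integralZl// -mulrA [leRHS]EFinM lee_wpmul2l ?lee_fin//.
  rewrite /Phi (@fubini_tonelli _ _ _ _ _ mu mu H mH H0).
  under eq_integral => y _.
    rewrite /H /=; under eq_integral do rewrite mulrC EFinM.
    rewrite ge0_integralZl//; last 3 first.
    - apply/measurable_EFinP; apply: (measurableT_comp maG (g := fun x : V => (x - y)%R)).
      by apply/measurable_fun_rVP => i; under eq_fun do rewrite !mxE; apply: measurable_funB => //; exact: measurable_coord.
    - by move=> x _; rewrite lee_fin.
    - by rewrite lee_fin.
    rewrite (@ge0_integral_shift y (fun x => (aG x)%:E)) ?gE; last 2 first.
    - exact/measurable_EFinP.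
    - by move=> x; rewrite lee_fin.
    over.
  rewrite ge0_integralZr//.
  - rewrite muleC EFinM; apply: lee_wpmul2l; first by rewrite lee_fin.
    exact: ltW.
  - exact/measurable_EFinP.
  - by move=> x _; rewrite lee_fin.
apply/eqP; rewrite eq_le measure_ge0 andbT.
suff : (2^-1)%:E * mu K <= 0.
  by rewrite -[X in _ <= X](mule0 2^-1%:E) lee_pmul2l ?lte_fin ?invr_gt0.
apply/lee_addgt0Pr => e e0; rewrite add0e.
have e1 : (0 < e / (c * g + 1))%R by rewrite divr_gt0// ltr_wpDl// mulr_ge0.
apply: le_trans (bound _ e1) _; rewrite lee_fin mulrCA ler_piMr ?(ltW e0)//.
by rewrite ler_pdivrMr ?ltr_wpDl ?mulr_ge0// mul1r lerDl.
Qed.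

End capacity.

(** Comparison with the larger of |a| and |b|. The constant is not sharp, but enough to see that
    sums stay in the function spaces. *)
Lemma ler_powRD {R : realType} (r a b : R) : 0 <= r ->
  `|a + b| `^ r <= 2 `^ r * (`|a| `^ r + `|b| `^ r).
Proof.
move=> r0; pose m := Num.max `|a| `|b|.
have m0 : 0 <= m by rewrite le_max normr_ge0.
have abm : `|a + b| <= 2 * m.
  by rewrite (le_trans (ler_normD _ _))// mulrDl mul1r lerD// le_max lexx ?orbT.
apply: (@le_trans _ _ ((2 * m) `^ r)).
  by rewrite ge0_ler_powR// ?nnegrE ?mulr_ge0.
rewrite powRM// ler_wpM2l ?powR_ge0// /m.
by case: (leP `|a| `|b|) => _; [rewrite lerDr|rewrite lerDl]; exact: powR_ge0.
Qed.

(** * The norm of M as a family of bounds on compact sets *)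

Section multiplier_norm.
Context {R : realType} {n : nat}.
Local Notation V := 'rV[R]_n.
Local Notation mu := (lebesgue_rV n).
Local Open Scope ereal_scope.
Implicit Types (g h f : V -> R) (K : set V).
Variables (G : V -> R) (s p : R).
Hypothesis p1 : (1 < p)%R.
Local Notation cap := (bessel_cap G s).
Hypothesis cap_lty : forall E : set V, bounded_set E -> cap E < +oo.
Hypothesis cap_eq0 : forall K : set V, measurable K -> cap K = 0 -> mu K = 0.

Let p0 : (0 < p)%R. Proof. exact: lt_trans p1. Qed.

Lemma cap_fin_num (K : set V) : compact K -> cap K \is a fin_num.
Proof.
move=> cK; rewrite ge0_fin_numE ?bessel_cap_ge0//; apply: cap_lty.
exact: compact_bounded.
Qed.

(** This ball keeps the index set of the supremum in [M_norm] nonempty, so that the norm is never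
    -oo. It contains a box of volume 2^n, hence is not null. *)
Lemma cap_cball_neq0 : cap (cball 1) != 0.
Proof.
apply/eqP => /(cap_eq0 (@measurable_cball R n 1%R)) B0.
pose b : V := const_mx 1%R.
have := @lebesgue_rV_box R n (- b)%R b.
set S := [set x | _]; have -> : mu S = 0.
  apply/eqP; rewrite eq_le measure_ge0 andbT -B0; apply: le_measure; rewrite ?inE.
  - exact: measurable_box_rV.
  - exact: measurable_cball.
  - move=> x Sx; rewrite /cball /= [leLHS]/Num.norm /= mx_normrE.
    apply: bigmax_le => // -[i j] _ /=; rewrite (ord1 i).
    by have := Sx j; rewrite !mxE in_itv /= ler_norml.
move=> H; have : 0 = (\prod_(i < n) (b ord0 i - (- b)%R ord0 i))%:E :> \bar R.
  by apply: H => i; rewrite !mxE; lra.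
case=> /esym/eqP; rewrite gt_eqF// prodr_gt0// => i _; rewrite !mxE; lra.
Qed.

Lemma M_norm_ge0 g : 0 <= M_norm G s p g.
Proof.
apply: ereal_sup_ge; exists (((\int[mu]_(x in cball 1) (`|g x| `^ p)%:E) / cap (cball 1)) `^ p^-1).
  by exists (cball 1) => //; split; [exact: compact_cball|exact: cap_cball_neq0].
exact: poweR_ge0.
Qed.

(** The inequality [M_norm G s p g <= c%:E] cleared of its quotient. Compact sets of capacity 0,
    absent from the supremum, are included: they are null, so both sides vanish on them. *)
Definition M_bound (c : R) (g : V -> R) := forall K : set V, compact K ->
  \int[mu]_(x in K) (`|g x| `^ p)%:E <= (c `^ p)%:E * cap K.

Lemma measurable_powR_norm g (D : set V) : measurable_fun setT g ->
  measurable_fun D (fun x => (`|g x| `^ p)%:E).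
Proof.
move=> mg; apply: measurable_funTS; apply/measurable_EFinP.
apply: (measurableT_comp (measurable_powR p)); exact: measurableT_comp.
Qed.

Lemma M_normP (c : R) g : measurable_fun setT g -> (0 <= c)%R ->
  M_norm G s p g <= c%:E <-> M_bound c g.
Proof.
move=> mg c0; split => [gc K cK|gc].
  have I0 : 0 <= \int[mu]_(x in K) (`|g x| `^ p)%:E.
    by apply: integral_ge0 => x _; rewrite lee_fin powR_ge0.
  have mK := compact_measurable_rV cK.
  have [K0|K0] := eqVneq (cap K) 0.
    rewrite K0 mule0 null_set_integral//; last exact: cap_eq0.
    exact: measurable_powR_norm.
  have : ((\int[mu]_(x in K) (`|g x| `^ p)%:E) / cap K) `^ p^-1 <= c%:E.
    by apply: le_trans gc; apply: ereal_sup_ubound; exists K.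
  have k0 : (0 < fine (cap K))%R.
    by rewrite fine_gt0// lt0e K0 bessel_cap_ge0/=; apply: cap_lty; exact: compact_bounded.
  rewrite -(fineK (cap_fin_num cK)) inver gt_eqF// => H.
  have : (((\int[mu]_(x in K) (`|g x| `^ p)%:E) / (fine (cap K))%:E) `^ p^-1) `^ p <= c%:E `^ p.
    apply: gt0_ler_poweR; rewrite ?(ltW p0)// ?in_itv/= ?andbT ?leey ?poweR_ge0 ?lee_fin ?c0//.
    by rewrite inver gt_eqF.
  rewrite -poweRrM mulVf ?gt_eqF// inver gt_eqF// poweRe1; last first.
    by rewrite mule_ge0// lee_fin invr_ge0 ltW.
  by rewrite poweR_EFin lee_pdivrMr.
apply: ub_ereal_sup => _ [K [cK K0] <-].
have k0 : (0 < fine (cap K))%R.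
  by rewrite fine_gt0// lt0e K0 bessel_cap_ge0/=; apply: cap_lty; exact: compact_bounded.
have I0 : 0 <= \int[mu]_(x in K) (`|g x| `^ p)%:E.
  by apply: integral_ge0 => x _; rewrite lee_fin powR_ge0.
have -> : c%:E = (c%:E `^ p) `^ p^-1.
  by rewrite -poweRrM mulfV ?gt_eqF// poweRe1.
apply: gt0_ler_poweR.
- by rewrite invr_ge0 ltW.
- by rewrite in_itv/= leey andbT mule_ge0// inve_ge0 bessel_cap_ge0.
- by rewrite in_itv/= ?leey ?andbT ?lee_fin ?powR_ge0.
- rewrite -(fineK (cap_fin_num cK)) inver gt_eqF// lee_pdivrMr// fineK ?cap_fin_num//.
  by rewrite poweR_EFin; exact: gc.
Qed.

(** Taking the constant positive allows dividing by it later, also when the norm of [g] is 0. *)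
Lemma M_spaceP g : M_space G s p g <-> measurable_fun setT g /\
  exists2 c, (0 < c)%R & M_bound c g.
Proof.
split=> [[mg _ Noo]|[mg [c c0 gc]]].
  split=> //; exists (fine (M_norm G s p g) + 1)%R.
    by rewrite ltr_wpDl// fine_ge0// M_norm_ge0.
  apply/M_normP => //; first by rewrite addr_ge0// fine_ge0// M_norm_ge0.
  by rewrite EFinD fineK ?leeDl// ge0_fin_numE// M_norm_ge0.
split=> // [K cK|]; last by apply: le_lt_trans (ltry c); apply/M_normP => //; exact: ltW.
apply: le_lt_trans (gc _ cK) _.
by rewrite lte_mul_pinfty ?lee_fin ?powR_ge0//; apply: cap_lty; exact: compact_bounded.
Qed.

Lemma M_space_lin (k : R) g h : M_space G s p g -> M_space G s p h ->
  M_space G s p (fun x => k * g x + h x)%R.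
Proof.
move=> /M_spaceP[mg [c c0 gc]] /M_spaceP[mh [d d0 hd]].
have mkg : measurable_fun setT (fun x => k * g x + h x)%R.
  by apply: measurable_funD => //; exact: measurable_funM.
apply/M_spaceP; split => //.
pose e := (2 `^ p * (`|k| `^ p * c `^ p + d `^ p))%R.
have e0 : (0 < e)%R.
  by rewrite mulr_gt0 ?powR_gt0// ltr_wpDl ?powR_gt0// mulr_ge0 ?powR_ge0.
exists (e `^ p^-1)%R; first exact: powR_gt0.
move=> K cK; rewrite -powRrM mulVf ?gt_eqF// powRr1 ?(ltW e0)//.
have mK := compact_measurable_rV cK.
apply: (@le_trans _ _ (\int[mu]_(x in K) ((2 `^ p)%:E * ((`|k| `^ p)%:E * (`|g x| `^ p)%:E + (`|h x| `^ p)%:E)))).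
  apply: ge0_le_integral => //.
  - exact: (measurable_powR_norm mkg).
  - apply: emeasurable_funM => //; apply: emeasurable_funD.
      by apply: emeasurable_funM => //; exact: measurable_powR_norm.
    exact: measurable_powR_norm.
  - move=> x _; rewrite lee_fin (le_trans (ler_powRD _ _ (ltW p0)))//.
    by rewrite normrM powRM.
rewrite ge0_integralZl//; last 2 first.
- apply: emeasurable_funD; last exact: measurable_powR_norm.
  by apply: emeasurable_funM => //; exact: measurable_powR_norm.
- by move=> x _; rewrite -EFinM -EFinD lee_fin addr_ge0 ?mulr_ge0 ?powR_ge0.
rewrite ge0_integralD//; last 2 first.
- by apply: emeasurable_funM => //; exact: measurable_powR_norm.
- exact: measurable_powR_norm.
rewrite ge0_integralZl//; last exact: measurable_powR_norm.
rewrite /e EFinM -muleA lee_wpmul2l ?lee_fin ?powR_ge0// EFinD ge0_muleDl ?lee_fin ?mulr_ge0 ?powR_ge0//.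
rewrite leeD//; last exact: hd.
by rewrite EFinM -muleA lee_wpmul2l ?lee_fin ?powR_ge0//; exact: gc.
Qed.

End multiplier_norm.

(** * Radon-Nikodym densities of real set functions *)

Section density.
Local Open Scope ereal_scope.

Lemma sigma_additive_density d (T : measurableType d) (R : realType)
    (mu : {sigma_finite_measure set T -> \bar R}) (nu : set T -> R) :
  nu set0 = 0%R -> semi_sigma_additive (EFin \o nu) ->
  (forall A, measurable A -> mu A = 0 -> nu A = 0%R) ->
  exists g : T -> R, [/\ measurable_fun setT g, mu.-integrable setT (EFin \o g) &
    forall A, measurable A -> (nu A)%:E = \int[mu]_(x in A) (g x)%:E].
Proof.
move=> nu0 nuS numu.
have nu0' : (EFin \o nu) set0 = 0 by rewrite /= nu0.
have nufin A : measurable A -> (EFin \o nu) A \is a fin_num by [].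
pose nuC : {charge set T -> \bar R} :=
  HB.pack (EFin \o nu) (@isCharge.Build _ _ _ (EFin \o nu) nu0' nufin nuS).
have nuCmu : nuC `<< mu.
  by apply/null_content_dominatesP => A mA muA; rewrite /nuC /= numu.
pose g x := fine (Radon_Nikodym nuC mu x).
have gE : EFin \o g = Radon_Nikodym nuC mu.
  by apply/funext => x; rewrite /= fineK// Radon_Nikodym_fin_num.
have ig : mu.-integrable setT (EFin \o g) by rewrite gE; exact: Radon_Nikodym_integrable.
exists g; split => //; first by apply/measurable_EFinP; exact: measurable_int ig.
move=> A mA; rewrite -[LHS]/(nuC A) (Radon_Nikodym_integral nuCmu mA).
by apply: eq_integral => x _; rewrite -gE.
Qed.

End density.

(** * Conjugate exponents and the extremal function of Hölder's inequality *)

Section exponents.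
Context {R : realType}.
Variable p : R.
Hypothesis p1 : 1 < p.
Local Notation q := (p / (p - 1)).

Lemma conj_gt0 : 0 < q.
Proof. by rewrite divr_gt0 ?subr_gt0// (lt_trans _ p1). Qed.

Lemma conj_sum : p^-1 + q^-1 = 1.
Proof.
have p0 : p != 0 by rewrite gt_eqF// (lt_trans _ p1).
by rewrite invf_div -{1}(div1r p) -mulrDl addrC subrK divff.
Qed.

Lemma conj_mul : (p - 1) * q = p.
Proof. by rewrite mulrC divfK// gt_eqF// subr_gt0. Qed.

(* sgn t |t|^(p - 1); the value at t = 0 is 0 even for p < 2, as [0 `^ r] is 0 or 1. *)
Definition sgpow (t : R) := t * `|t| `^ (p - 2).

Lemma norm_sgpow t : `|sgpow t| = `|t| `^ (p - 1).
Proof.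
have [->|t0] := eqVneq t 0.
  by rewrite /sgpow mul0r !normr0 powR0// gt_eqF// subr_gt0.
rewrite /sgpow normrM (ger0_norm (powR_ge0 _ _)) -{1}(powRr1 (normr_ge0 t)).
rewrite -powRD; first by congr (_ `^ _); ring.
by apply/implyP => _; rewrite normr_eq0.
Qed.

Lemma sgpowM t : sgpow t * t = `|t| `^ p.
Proof.
have [->|t0] := eqVneq t 0.
  by rewrite mulr0 normr0 powR0// gt_eqF// (lt_trans _ p1).
rewrite /sgpow mulrAC -expr2 -real_normK ?num_real//.
rewrite -(powR_mulrn 2 (normr_ge0 t)) -powRD; first by congr (_ `^ _); ring.
by apply/implyP => _; rewrite normr_eq0.
Qed.

Lemma norm_sgpow_conj t : `|sgpow t| `^ q = `|t| `^ p.
Proof. by rewrite norm_sgpow -powRrM conj_mul. Qed.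

Lemma measurable_sgpow d (T : measurableType d) (g : T -> R) :
  measurable_fun setT g -> measurable_fun setT (fun x => sgpow (g x)).
Proof.
move=> mg; apply: measurable_funM => //.
apply: (measurableT_comp (measurable_powR _)); exact: measurableT_comp.
Qed.

(* [I] is the integral of |g|^p over a set, [k] the capacity of a compact set
   containing it; the leading factor normalizes the test function [sgpow g]. *)
Lemma test_scalar (I k c : R) : 0 < I -> 0 < k -> 0 <= c ->
  (I `^ q^-1 * k `^ p^-1)^-1 * I <= c -> I <= c `^ p * k.
Proof.
move=> I0 k0 c0.
have p0 : 0 < p by rewrite (lt_trans _ p1).
have -> : (I `^ q^-1 * k `^ p^-1)^-1 * I = I `^ p^-1 / k `^ p^-1.
  have IE : I = I `^ p^-1 * I `^ q^-1.
    rewrite -powRD ?conj_sum ?powRr1 ?(ltW I0)//.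
    by rewrite oner_eq0.
  rewrite {2}IE invfM; have := powR_gt0 q^-1 I0 => /gt_eqF/negbT; move: (I `^ _) (I `^ _) (k `^ _) => a b e a0.
  by rewrite mulrC mulrA mulfK.
rewrite ler_pdivrMr ?powR_gt0// => H.
have : (I `^ p^-1) `^ p <= (c * k `^ p^-1) `^ p.
  by rewrite ge0_ler_powR ?nnegrE ?powR_ge0 ?mulr_ge0 ?powR_ge0 ?(ltW p0).
rewrite powRM ?powR_ge0// -!powRrM mulVf ?gt_eqF// !powRr1 ?(ltW I0) ?(ltW k0)//.
Qed.

End exponents.

(** * Preduals of M *)

Section predual.
Context {R : realType} {n : nat}.
Local Notation V := 'rV[R]_n.
Local Notation mu := (lebesgue_rV n).
Local Open Scope ereal_scope.
Implicit Types (f g h : V -> R) (K A S : set V) (c e : R).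
Variables (G : V -> R) (s p : R).
Hypothesis p1 : (1 < p)%R.
Local Notation cap := (bessel_cap G s).
Hypothesis cap_lty : forall E : set V, bounded_set E -> cap E < +oo.
Hypothesis cap_eq0 : forall K : set V, measurable K -> cap K = 0 -> mu K = 0.
Local Notation q := (p / (p - 1))%R.

Let p0 : (0 < p)%R. Proof. exact: lt_trans p1. Qed.
Let q0 : (0 < q)%R. Proof. exact: conj_gt0. Qed.

Definition Lq_integral f := \int[mu]_x (`|f x| `^ q)%:E.

(** Vanishing outside [K] is required at every point: functionals act on functions rather than on
    classes, so the decompositions fed to them have to be pointwise identities. *)
Definition supported_Lq K f := [/\ measurable_fun setT f,
  forall x, ~ K x -> f x = 0%R & Lq_integral f < +oo].

Lemma Lq_integral_ge0 f : 0 <= Lq_integral f.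
Proof. by apply: integral_ge0 => x _; rewrite lee_fin powR_ge0. Qed.

Lemma supported_Lq0 K : supported_Lq K (fun=> 0%R) /\ Lq_integral (fun=> 0%R) = 0.
Proof.
have LE : Lq_integral (fun=> 0%R) = 0.
  rewrite /Lq_integral; under eq_integral do rewrite normr0 powR0 ?gt_eqF//.
  by rewrite integral0.
by split => //; split => //; rewrite LE.
Qed.

(** The interface through which the duality argument sees either space. Bounds against elements of M
    are phrased with [M_bound], which avoids dividing by capacities, and the difference in
    [predual_approx] has the shape produced by [predual_lin]. *)
Record predual (X : set (V -> R)) (N : (V -> R) -> \bar R) : Prop := {
  predual_measurable : forall f, X f -> measurable_fun setT f ;
  predual_lin : forall (k : R) f g, X f -> X g -> X (fun x => k * f x + g x)%R ;
  predual_norm_fin : forall f, X f -> N f \is a fin_num ;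
  predual_norm_ge0 : forall f, X f -> 0 <= N f ;
  predual_atom : forall K f, compact K -> supported_Lq K f ->
    X f /\ N f <= Lq_integral f `^ q^-1 * cap K `^ p^-1 ;
  predual_hoelder : forall f g c, X f -> measurable_fun setT g -> (0 < c)%R ->
    M_bound G s p c g -> \int[mu]_x `|f x * g x|%:E <= c%:E * N f ;
  predual_approx : forall f e, X f -> (0 < e)%R -> exists K h,
    [/\ compact K, supported_Lq K h & N (fun x => -1 * h x + f x)%R <= e%:E] }.

Lemma supported_LqS K K' f : K `<=` K' -> supported_Lq K f -> supported_Lq K' f.
Proof. by move=> KK' [mf f0 foo]; split => // x /(contra_not (@KK' x)); exact: f0. Qed.

Lemma compact_measure_lty K : compact K -> mu K < +oo.
Proof.
move=> cK; have [r [_ Kr]] := compact_subset_cball cK.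
apply: le_lt_trans (lebesgue_rV_cball_lty n r).
by apply: le_measure; rewrite ?inE//; [exact: compact_measurable_rV|exact: measurable_cball].
Qed.

Lemma supported_indic K S : compact K -> measurable S -> S `<=` K ->
  supported_Lq K (\1_S) /\ Lq_integral (\1_S) = mu S.
Proof.
move=> cK mS SK.
have LE : Lq_integral (\1_S) = mu S.
  rewrite -(setIT S) -integral_indic// setIT; apply: eq_integral => x _.
  by rewrite indicE; case: (x \in S); rewrite ?normr1 ?powR1// normr0 powR0// gt_eqF.
split=> //; split.
- exact: measurable_indic.
- by move=> x nKx; rewrite indicE memNset// => /SK.
- rewrite LE; apply: le_lt_trans (compact_measure_lty cK).
  by apply: le_measure; rewrite ?inE//; exact: compact_measurable_rV.
Qed.

Section in_predual.
Variables (X : set (V -> R)) (N : (V -> R) -> \bar R).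
Hypothesis XN : predual X N.

Lemma predual0 : X (fun=> 0%R).
Proof.
have [s0 _] := supported_Lq0 (@cball R n 0%R).
by have [] := predual_atom XN (@compact_cball R n 0%R) s0.
Qed.

Lemma predual_integrable f g c : X f -> measurable_fun setT g -> (0 < c)%R ->
  M_bound G s p c g -> mu.-integrable setT (fun x => (f x * g x)%:E).
Proof.
move=> Xf mg c0 gc; have mf := predual_measurable XN Xf.
apply/integrableP; split.
  by apply/measurable_EFinP; exact: measurable_funM.
apply: le_lt_trans (predual_hoelder XN Xf mg c0 gc) _.
by rewrite lte_mul_pinfty ?lee_fin ?(ltW c0)// ltey_eq (predual_norm_fin XN Xf).
Qed.

(** The equality case of Hölder's inequality: f is a multiple of sgn(g) |g|^(p - 1) on [A],
    normalized through [predual_atom]. [A] is kept apart from [K] because a density is not known in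
    advance to be in L^p(K) and is tested where it is bounded. The hypothesis on f may assume f g
    integrable for the same reason. *)
Lemma predual_test c g K A : (0 <= c)%R -> measurable_fun setT g ->
  compact K -> measurable A -> A `<=` K ->
  \int[mu]_(x in A) (`|g x| `^ p)%:E < +oo ->
  (forall f, supported_Lq K f -> N f <= 1 ->
    mu.-integrable setT (fun x => (f x * g x)%:E) ->
    \int[mu]_x (f x * g x)%:E <= c%:E) ->
  \int[mu]_(x in A) (`|g x| `^ p)%:E <= (c `^ p)%:E * cap K.
Proof.
move=> c0 mg cK mA AK Aoo H.
have mK := compact_measurable_rV cK.
have mgp := @measurable_powR_norm R n p g setT mg.
have I0 : 0 <= \int[mu]_(x in A) (`|g x| `^ p)%:E.
  by apply: integral_ge0 => x _; rewrite lee_fin powR_ge0.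
have [IE|In0] := eqVneq (\int[mu]_(x in A) (`|g x| `^ p)%:E) 0.
  by rewrite IE mule_ge0// ?lee_fin ?powR_ge0// bessel_cap_ge0.
have [K0|Kn0] := eqVneq (cap K) 0.
  have A0 : mu A = 0.
    apply/eqP; rewrite eq_le measure_ge0 andbT -(cap_eq0 mK K0).
    by apply: le_measure; rewrite ?inE.
  by rewrite null_set_integral ?eqxx// in In0; exact: measurable_funTS.
have fK := cap_fin_num cap_lty cK.
have k0 : (0 < fine (cap K))%R.
  by rewrite fine_gt0// lt0e Kn0 bessel_cap_ge0/= ltey_eq fK.
have fI : \int[mu]_(x in A) (`|g x| `^ p)%:E \is a fin_num by rewrite ge0_fin_numE.
have i0 : (0 < fine (\int[mu]_(x in A) (`|g x| `^ p)%:E))%R.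
  by rewrite fine_gt0// lt0e In0 I0.
pose I := fine (\int[mu]_(x in A) (`|g x| `^ p)%:E).
pose k := fine (cap K).
(* As |sgpow t|^q = |t|^p, this factor makes the bound of [predual_atom] on the norm of the test
   function exactly 1. *)
pose l := (I `^ q^-1 * k `^ p^-1)^-1%R.
have l0 : (0 < l)%R by rewrite invr_gt0 mulr_gt0 ?powR_gt0.
pose f x := (l * sgpow p (g x) * \1_A x)%R.
have mf : measurable_fun setT f.
  apply: measurable_funM; last exact: measurable_indic.
  by apply: measurable_funM => //; exact: measurable_sgpow.
have LfE : Lq_integral f = (l `^ q * I)%:E.
  rewrite EFinM /I fineK// -ge0_integralZl//; [|exact: measurable_funTS|by rewrite lee_fin powR_ge0].
  rewrite [RHS]integral_mkcond; apply: eq_integral => x _.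
  rewrite patchE /f indicE; case: (x \in A) => /=.
    by rewrite mulr1 normrM powRM// norm_sgpow_conj// ger0_norm ?(ltW l0).
  by rewrite mulr0 normr0 powR0// gt_eqF.
have sf : supported_Lq K f.
  split; [exact: mf|move=> x nKx|by rewrite LfE ltry].
  by rewrite /f indicE memNset ?mulr0// => /AK.
have [Xf Nf] := predual_atom XN cK sf.
have Nf1 : N f <= 1.
  apply: le_trans Nf _; rewrite LfE -(fineK fK) !poweR_EFin -EFinM lee_fin -/k.
  rewrite powRM ?powR_ge0 ?(ltW i0)// -powRrM mulfV ?gt_eqF// powRr1 ?(ltW l0)//.
  by rewrite -mulrA /l mulVf// gt_eqF// mulr_gt0 ?powR_gt0.
have fgE x : (f x * g x)%:E = l%:E * ((`|g x| `^ p)%:E * (\1_A x)%:E).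
  by rewrite /f mulrAC -(mulrA l) sgpowM// -!EFinM mulrA.
have ifg : \int[mu]_x (f x * g x)%:E = (l * I)%:E.
  under eq_integral do rewrite fgE.
  rewrite ge0_integralZl//; last 2 first.
  - by apply: emeasurable_funM => //; apply/measurable_EFinP; exact: measurable_indic.
  - by rewrite lee_fin (ltW l0).
  rewrite EFinM /I fineK//; congr (_ * _); rewrite [RHS]integral_mkcond.
  apply: eq_integral => x _; rewrite patchE indicE.
  by case: (x \in A); rewrite ?mule1 ?mule0.
have {}H : (l * I <= c)%R.
  rewrite -lee_fin -ifg; apply: H => //; apply/integrableP; split.
    by apply/measurable_EFinP; exact: measurable_funM.
  under eq_integral => x _.
    rewrite gee0_abs; last first.
      by rewrite fgE !mule_ge0 ?lee_fin ?(ltW l0) ?powR_ge0//.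
    over.
  by rewrite ifg ltry.
rewrite -(fineK fI) -(fineK fK) -EFinM lee_fin -/I -/k.
exact: test_scalar.
Qed.

End in_predual.

End predual.
Lemma powR_norm_cvg0 {R : realType} (u : R^nat) (q : R) : (0 < q)%R ->
  u k @[k --> \oo] --> 0 -> `|u k| `^ q @[k --> \oo] --> 0.
Proof.
move=> q0 /cvgrPdist_le u0; apply/cvgrPdist_le => e e0.
have e1 : 0 < e `^ q^-1 by exact: powR_gt0.
near=> k; rewrite sub0r normrN ger0_norm ?powR_ge0//.
have -> : e = (e `^ q^-1) `^ q by rewrite -powRrM mulVf ?gt_eqF// powRr1// ltW.
rewrite ge0_ler_powR ?nnegrE ?(ltW q0) ?powR_ge0//.
rewrite -normrN -sub0r; near: k; exact: u0.
Unshelve. all: by end_near. Qed.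

(** * Representation of bounded functionals *)

Section representation.
Context {R : realType} {n : nat}.
Local Notation V := 'rV[R]_n.
Local Notation mu := (lebesgue_rV n).
Local Open Scope ereal_scope.
Implicit Types (f g h : V -> R) (K A S D : set V) (c e r : R).
Variables (G : V -> R) (s p : R).
Hypothesis p1 : (1 < p)%R.
Local Notation cap := (bessel_cap G s).
Hypothesis cap_lty : forall E : set V, bounded_set E -> cap E < +oo.
Hypothesis cap_eq0 : forall K : set V, measurable K -> cap K = 0 -> mu K = 0.
Local Notation q := (p / (p - 1))%R.
Variables (X : set (V -> R)) (N : (V -> R) -> \bar R).
Hypothesis XN : predual G s p X N.
Variables (L : (V -> R) -> R) (C : R).
Hypothesis L_lin : forall (k : R) f g, X f -> X g ->
  L (fun x => k * f x + g x)%R = (k * L f + L g)%R.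
Hypothesis C0 : (0 < C)%R.
Hypothesis L_bound : forall f, X f -> `|L f|%:E <= C%:E * N f.

Let p0 : (0 < p)%R. Proof. exact: lt_trans p1. Qed.
Let q0 : (0 < q)%R. Proof. exact: conj_gt0. Qed.

Lemma supported_X K f : compact K -> supported_Lq p K f -> X f.
Proof. by move=> cK sf; have [] := predual_atom XN cK sf. Qed.

Lemma functional0 : L (fun=> 0%R) = 0%R.
Proof.
have X0 := predual0 p1 XN.
have := L_lin 1%R X0 X0.
under [Y in L Y = _ -> _]eq_fun do rewrite mulr0 addr0.
lra.
Qed.

Lemma functionalZ k f : X f -> L (fun x => k * f x)%R = (k * L f)%R.
Proof.
move=> Xf; have := L_lin k Xf (predual0 p1 XN).
under [Y in L Y = _ -> _]eq_fun do rewrite addr0.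
by rewrite functional0 addr0.
Qed.

Lemma predualZ k f : X f -> X (fun x => k * f x)%R.
Proof.
move=> Xf; have := predual_lin XN k Xf (predual0 p1 XN).
by under [Y in X Y -> _]eq_fun do rewrite addr0.
Qed.

Lemma predualD f g : X f -> X g -> X (fun x => f x + g x)%R.
Proof.
move=> Xf Xg; have := predual_lin XN 1%R Xf Xg.
by under [Y in X Y -> _]eq_fun do rewrite mul1r.
Qed.

Lemma functionalD f g : X f -> X g -> L (fun x => f x + g x)%R = (L f + L g)%R.
Proof.
move=> Xf Xg; have := L_lin 1%R Xf Xg.
by under [Y in L Y = _ -> _]eq_fun do rewrite mul1r; rewrite mul1r.
Qed.

(** Continuity of [L] at 0 for the L^q norm on a fixed ball. It serves three times: the set function
    vanishes on null sets, it is countably additive, and [L] commutes with limits of simple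
    functions. *)
Lemma functional_small r e : (0 < e)%R -> exists2 d, (0 < d)%R &
  forall f, supported_Lq p (cball r) f -> Lq_integral p f <= d%:E -> (`|L f| <= e)%R.
Proof.
move=> e0; have cK := @compact_cball R n r.
pose k := fine (cap (cball r)).
have k0 : (0 <= k)%R by rewrite fine_ge0// bessel_cap_ge0.
(* [m] exceeds the constant C k^(1/p) of the estimate; adding 1 keeps it positive when the capacity
   of the ball is 0. *)
pose m := (C * k `^ p^-1 + 1)%R.
have m0 : (0 < m)%R by rewrite ltr_wpDl// mulr_ge0 ?powR_ge0// ltW.
have em0 : (0 < e / m)%R by rewrite divr_gt0.
exists ((e / m) `^ q)%R; first exact: powR_gt0.
move=> f sf fd; have [Xf Nf] := predual_atom XN cK sf.
rewrite -lee_fin; apply: le_trans (L_bound Xf) _.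
apply: (@le_trans _ _ (C%:E * ((e / m)%:E * (k `^ p^-1)%:E))).
  rewrite lee_wpmul2l ?lee_fin ?(ltW C0)//; apply: le_trans Nf _.
  rewrite -(fineK (cap_fin_num cap_lty cK)) -/k lee_wpmul2r ?lee_fin ?powR_ge0//.
  have -> : (e / m)%:E = ((e / m) `^ q)%:E `^ q^-1.
    by rewrite poweR_EFin -powRrM mulfV ?gt_eqF// powRr1// ltW.
  apply: gt0_ler_poweR => //; first by rewrite invr_ge0 ltW.
    by rewrite in_itv/= leey andbT Lq_integral_ge0.
  by rewrite in_itv/= ?leey ?andbT ?lee_fin powR_ge0.
rewrite -!EFinM lee_fin mulrCA -mulrA ler_piMr ?(ltW e0)// mulrC ler_pdivrMr// mul1r.
by rewrite /m lerDl.
Qed.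

Lemma functional_indicU K A B : compact K -> measurable A -> measurable B ->
  A `<=` K -> B `<=` K -> A `&` B = set0 -> L (\1_(A `|` B)) = (L (\1_A) + L (\1_B))%R.
Proof.
move=> cK mA mB AK BK AB0.
have [sA _] := supported_indic p1 cK mA AK.
have [sB _] := supported_indic p1 cK mB BK.
rewrite -(functionalD (supported_X cK sA) (supported_X cK sB)); congr L.
apply/funext => x; rewrite !indicE in_setU.
have := AB0 => /seteqP[/(_ x) + _]; rewrite /= => H.
have [xA|xA] := boolP (x \in A); have [xB|xB] := boolP (x \in B); rewrite /= ?addr0 ?add0r//.
by exfalso; apply: H; split; exact: set_mem.
Qed.

Lemma functional_density r D : measurable D -> D `<=` cball r ->
  exists g, [/\ measurable_fun setT g, mu.-integrable setT (EFin \o g) &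
    forall A, measurable A -> A `<=` D -> (L (\1_A))%:E = \int[mu]_(x in A) (g x)%:E].
Proof.
move=> mD Dr; have cK := @compact_cball R n r.
(* Intersecting with [D] gives a finite set function defined on all Borel sets. *)
pose nu A := L (\1_(A `&` D)).
have ID A : A `&` D `<=` cball r by move=> x [_ /Dr].
have nu0 : nu set0 = 0%R by rewrite /nu set0I indic0 functional0.
have numu A : measurable A -> mu A = 0 -> nu A = 0%R.
  move=> mA A0; have mAD : measurable (A `&` D) by exact: measurableI.
  apply/eqP; rewrite -normr_le0; apply/ler_addgt0Pr => e e0; rewrite add0r.
  have [d d0 H] := functional_small r e0.
  have [sAD LAD] := supported_indic p1 cK mAD (@ID A).
  apply: H => //; rewrite LAD (@le_trans _ _ (mu A)) ?A0 ?lee_fin ?(ltW d0)//.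
  by rewrite -A0; apply: le_measure; rewrite ?inE//; exact: subIsetl.
have nuS : semi_sigma_additive (EFin \o nu).
  move=> F mF tF mUF.
  (* What the first k sets leave of the union. By finite additivity the remainder of the series is
     [L] of its indicator, and these sets decrease to the empty set inside a ball of finite
     measure. *)
  pose T k := (\bigcup_n F n `\` \big[setU/set0]_(i < k) F i) `&` D.
  have mT k : measurable (T k).
    by apply: measurableI => //; apply: measurableD => //; exact: bigsetU_measurable.
  have Tr k : T k `<=` cball r by exact: ID.
  have step k : nu (\bigcup_n F n) = (\sum_(0 <= i < k) nu (F i) + L (\1_(T k)))%R.
    elim: k => [|k IHk].
      by rewrite big_geq// add0r /T big_ord0 setD0.
    rewrite IHk big_nat_recr//= -addrA; congr (_ + _)%R.
    rewrite -(functional_indicU cK) => //; last 2 first.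
    - exact: measurableI.
    - rewrite -subset0 => x [[Fx _] [[_ nF] _]]; apply: nF.
      by rewrite big_ord_recr/=; right.
    congr (L (\1_ _)); apply/seteqP; split => x.
      move=> [[[i _ Fi] nF] Dx]; have [Fk|nFk] := pselect (F k x); [by left|right].
      by split=> //; split; [exists i|rewrite big_ord_recr/= => -[]].
    move=> [[Fk Dx]|[[UF nF] Dx]]; split => //.
      split; first by exists k.
      rewrite -bigcup_mkord => -[i /= ik Fi].
      have /trivIsetP/(_ i k I I) := tF.
      by rewrite (ltn_eqF ik) => /(_ isT) /seteqP[/(_ x) + _]; apply.
    by split => //; apply: contra_not nF; rewrite big_ord_recr/=; left.
  have T0 : mu (T k) @[k --> \oo] --> 0.
    have <- : mu (\bigcap_k T k) = 0.
      rewrite (_ : \bigcap_k T k = set0) ?measure0// -subset0 => x Tx.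
      have [[[i _ Fi] _] _] := Tx 0%N I.
      have [[_ + ] _] := Tx i.+1 I; apply; rewrite big_ord_recr/=; right.
      exact: Fi.
    apply: nonincreasing_cvg_mu => //.
    - apply: le_lt_trans (compact_measure_lty cK).
      by apply: le_measure; rewrite ?inE//; exact: measurable_cball.
    - exact: bigcap_measurable.
    - move=> i j ij; apply/subsetPset; apply: setSI; apply: setDS.
      exact: subset_bigsetU.
  have -> : (fun k => \sum_(0 <= i < k) (EFin \o nu) (F i)) =
      (fun k => (\sum_(0 <= i < k) nu (F i))%:E).
    by apply/funext => k; rewrite sumEFin.
  apply/fine_cvgP; split; first exact: nearW.
  apply/cvgrPdist_le => e e0 /=.
  have [d d0 H] := functional_small r e0.
  move/fine_cvgP : T0 => [Tfin /cvgrPdist_le/(_ _ d0) Td].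
  near=> k; rewrite (step k) addrC addKr.
  have [sT LT] := supported_indic p1 cK (mT k) (Tr k).
  apply: H => //; rewrite LT -(@fineK _ (mu (T k))); last by near: k.
  rewrite lee_fin (le_trans (ler_norm _))//.
  rewrite -normrN -sub0r; near: k; exact: Td.
have [g [mg ig gE]] := sigma_additive_density nu0 nuS numu.
exists g; split => // A mA AD; rewrite -gE// /nu.
by congr (L (\1_ _))%:E; apply/esym/setIidPl.
Unshelve. all: by end_near. Qed.

(** The shells k <= |x| < k + 1 partition the space, so the densities found on them are glued by
    [Num.truncn] with no overlaps to reconcile. A bounded set meets finitely many shells, and finite
    additivity concludes. *)
Lemma functional_global_density : exists2 g, measurable_fun setT g &
  forall r S, measurable S -> S `<=` cball r ->
    mu.-integrable S (EFin \o g) /\ (L (\1_S))%:E = \int[mu]_(x in S) (g x)%:E.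
Proof.
pose B k : set V := [set x | (`|x| < k%:R)%R].
pose D k := B k.+1 `\` B k.
have mB k : measurable (B k).
  apply: open_measurable_rV.
  rewrite (_ : B k = (fun x : V => `|x|%R) @^-1` [set t | (t < k%:R)%R])//.
  apply: open_comp; last exact: open_lt.
  by move=> x _; exact: norm_continuous.
have mD k : measurable (D k) by exact: measurableD.
have Br k : B k `<=` cball k%:R by move=> x /ltW.
have Dr k : D k `<=` cball k.+1%:R by move=> x [/Br].
have /choice[g_ gP] k := functional_density (mD k) (@Dr k).
pose g x := g_ (Num.truncn `|x|%R) x.
have DE k x : D k x -> Num.truncn `|x|%R = k.
  by move=> [/= xk1 /negP]; rewrite -leNgt => xk; apply/eqP; rewrite truncn_eq// xk.
have gD k : {in D k, g =1 g_ k}.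
  by move=> x; rewrite inE => Dx; rewrite /g (DE _ _ Dx).
have DT : \bigcup_k D k = setT.
  rewrite -subTset => x _; exists (Num.truncn `|x|%R) => //; split => /=.
    exact: truncnS_gt.
  by apply/negP; rewrite -leNgt truncn_le.
have mg : measurable_fun setT g.
  move=> _ Y mY; rewrite setTI (_ : g @^-1` Y = \bigcup_k (D k `&` g_ k @^-1` Y)).
    apply: bigcup_measurable => k _; have [mgk _ _] := gP k.
    by apply: measurableI => //; rewrite -[X in measurable X]setTI; exact: mgk.
  apply/seteqP; split => [x Yx|x [k _ [Dx Yx]]].
    have : setT x by []; rewrite -DT => -[k _ Dx]; exists k => //; split => //.
    by rewrite /= -(gD k) ?inE.
  by rewrite /= (gD k) ?inE.
exists g => // r S mS Sr; have cK := @compact_cball R n r.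
have mSB k : measurable (S `&` B k) by exact: measurableI.
have SBr k : S `&` B k `<=` cball r by move=> x [/Sr].
have step k : mu.-integrable (S `&` B k) (EFin \o g) /\
    (L (\1_(S `&` B k)))%:E = \int[mu]_(x in S `&` B k) (g x)%:E.
  elim: k => [|k [ik Lk]].
    have -> : S `&` B 0%N = set0.
      by rewrite -subset0 => x [_]; rewrite /B /= ltNge normr_ge0.
    by split; [exact: integrable_set0|rewrite indic0 functional0 integral_set0].
  have SBE : S `&` B k.+1 = (S `&` B k) `|` (S `&` D k).
    apply/seteqP; split => [x [Sx Bx]|x [[Sx Bx]|[Sx [Bx _]]]]; last 2 first.
    - by split=> //; rewrite /B /= (lt_trans Bx)// ltr_nat.
    - by [].
    by have [Bk|nBk] := pselect (B k x); [left|right].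
  have SD0 : (S `&` B k) `&` (S `&` D k) = set0.
    by rewrite -subset0 => x [[_ Bx] [_ [_]]].
  have mSD : measurable (S `&` D k) by exact: measurableI.
  have SDr : S `&` D k `<=` cball r by move=> x [/Sr].
  have [mgk igk gkE] := gP k.
  have iD : mu.-integrable (S `&` D k) (EFin \o g).
    apply: (@eq_integrable _ _ _ mu _ mSD (EFin \o g_ k)).
      by move=> x; rewrite inE => -[_ Dx]; rewrite /= (gD k) ?inE.
    exact: integrableS igk.
  split.
    rewrite SBE; apply/integrableP; split; first by apply: measurable_funTS; exact/measurable_EFinP.
    rewrite ge0_integral_setU//=.
    - by rewrite lte_add_pinfty//; [case/integrableP : ik|case/integrableP : iD].
    - by apply: measurable_funTS; apply/measurable_EFinP; exact: measurableT_comp.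
    - by apply/disj_setPS; rewrite SD0.
  rewrite SBE (functional_indicU cK)// EFinD Lk (gkE _ mSD); last by move=> x [].
  rewrite integral_setU//; last 2 first.
  - by apply: measurable_funTS; exact/measurable_EFinP.
  - by apply/disj_setPS; rewrite SD0.
  congr (_ + _); apply: eq_integral => x; rewrite inE => -[_ Dx].
  by rewrite (gD k) ?inE.
have [k rk] : exists k, cball r `<=` B k.
  exists (Num.truncn `|r|%R).+1 => x xr; rewrite /B /=.
  by rewrite (le_lt_trans xr)// (le_lt_trans (ler_norm r))// truncnS_gt.
by have := step k; rewrite (setIidl _)// => x /Sr /rk.
Qed.

(** * From indicators to all of X *)

Section extension.
Variable g : V -> R.
Hypothesis mg : measurable_fun setT g.
Hypothesis gE : forall r S, measurable S -> S `<=` cball r ->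
  mu.-integrable S (EFin \o g) /\ (L (\1_S))%:E = \int[mu]_(x in S) (g x)%:E.

Let represented r f := [/\ supported_Lq p (cball r) f,
  mu.-integrable setT (fun x => (f x * g x)%:E) &
  (L f)%:E = \int[mu]_x (f x * g x)%:E].

Lemma functional_sum r m (c : 'I_m -> R) (S : 'I_m -> set V) :
  (forall i, measurable (S i)) -> (forall i, S i `<=` cball r) ->
  [/\ X (fun x => \sum_(i < m) c i * \1_(S i) x)%R,
   mu.-integrable setT (fun x => ((\sum_(i < m) c i * \1_(S i) x) * g x)%:E) &
   (L (fun x => \sum_(i < m) c i * \1_(S i) x)%R)%:E =
   \int[mu]_x ((\sum_(i < m) c i * \1_(S i) x) * g x)%:E].
Proof.
move=> mS Sr; have cK := @compact_cball R n r.
elim: m c S mS Sr => [|m IHm] c S mS Sr.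
  have -> : (fun x : V => \sum_(i < 0) c i * \1_(S i) x)%R = (fun=> 0%R).
    by apply/funext => x; rewrite big_ord0.
  have -> : (fun x : V => ((\sum_(i < 0) c i * \1_(S i) x) * g x)%:E) = cst 0.
    by apply/funext => x; rewrite big_ord0 mul0r.
  split; first exact: (predual0 p1 XN).
    exact: integrable0.
  by rewrite functional0 integral0.
have [Xm im Lm] := IHm (fun i => c (widen_ord (leqnSn m) i)) (fun i => S (widen_ord (leqnSn m) i)) (fun i => mS _) (fun i => Sr _).
set u := (fun x : V => \sum_(i < m) _)%R in Xm Lm.
pose T := S ord_max; pose t := c ord_max.
have -> : (fun x : V => \sum_(i < m.+1) c i * \1_(S i) x)%R =
    (fun x => u x + t * \1_T x)%R.
  by apply/funext => x; rewrite big_ord_recr.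
have -> : (fun x : V => ((\sum_(i < m.+1) c i * \1_(S i) x) * g x)%:E) =
    (fun x => (u x * g x)%:E + t%:E * ((EFin \o g) \_ T) x).
  apply/funext => x; rewrite big_ord_recr /= -/(u x) mulrDl EFinD patchE indicE -/T -/t.
  by congr (_ + _); case: (x \in T); rewrite ?mulr1 ?mulr0 ?mul0r ?mule0.
have [iT LT] := gE (mS ord_max) (Sr ord_max).
have [sT _] := supported_indic p1 cK (mS ord_max) (Sr ord_max).
have XT := supported_X cK sT.
have iT' : mu.-integrable setT ((EFin \o g) \_ T) by apply/(integrable_mkcond _ (mS _)).
have itT : mu.-integrable setT (fun x => t%:E * ((EFin \o g) \_ T) x).
  exact: integrableZl.
split.
- by apply: predualD => //; exact: predualZ.
- exact: integrableD.
rewrite functionalD//; last exact: predualZ.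
rewrite functionalZ// integralD// EFinD Lm integralZl//; congr (_ + _).
by rewrite EFinM LT [in LHS]integral_mkcond.
Qed.

Lemma supported_Lq_dominated r f h : supported_Lq p (cball r) f ->
  measurable_fun setT h -> (forall x, `|h x| <= `|f x|)%R ->
  supported_Lq p (cball r) h.
Proof.
move=> [mf f0 foo] mh hf; split; [exact: mh|move=> x nx|].
  by apply/eqP; rewrite -normr_le0 (le_trans (hf x))// f0// normr0.
apply: le_lt_trans foo; apply: ge0_le_integral => //.
- apply/measurable_EFinP; apply: (measurableT_comp (measurable_powR q)).
  exact: measurableT_comp.
- apply/measurable_EFinP; apply: (measurableT_comp (measurable_powR q)).
  exact: measurableT_comp.
- by move=> x _; rewrite lee_fin ge0_ler_powR ?nnegrE ?(ltW q0).
Qed.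

Import HBNNSimple.

(** Simple functions increase to f and both sides pass to the limit: [L] because |f - a_k|^q is
    dominated by |f|^q, the integral because |a_k g| is dominated by |f g|. The second domination is
    the reason to assume f g integrable, as [g] is so far only integrable on bounded sets. *)
Lemma functional_ge0 r f : (forall x, 0 <= f x)%R ->
  supported_Lq p (cball r) f -> mu.-integrable setT (fun x => (f x * g x)%:E) ->
  (L f)%:E = \int[mu]_x (f x * g x)%:E.
Proof.
move=> f0 sf ifg; have cK := @compact_cball R n r.
have [mf fr foo] := sf.
have mfE : measurable_fun setT (EFin \o f) by exact/measurable_EFinP.
pose a := nnsfun_approx measurableT mfE.
have a_le k x : (a k x <= f x)%R.
  rewrite /a nnsfun_approxE -lee_fin.
  by apply: (le_approx k (f := EFin \o f)) => // y _; rewrite lee_fin.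
have a_cvg x : a k x @[k --> \oo] --> f x.
  have /fine_cvgP[_] := cvg_nnsfun_approx measurableT mfE (fun y _ => f0 y) (x := x) I.
  exact.
have a0 k x : (0 <= a k x)%R by [].
have sa k : supported_Lq p (cball r) (a k).
  apply: (supported_Lq_dominated sf) => // x.
  by rewrite !ger0_norm.
have La k : mu.-integrable setT (fun x => (a k x * g x)%:E) /\
    (L (a k))%:E = \int[mu]_x (a k x * g x)%:E.
  pose sq := fset_set (a k @` setT).
  (* The level set of the value 0 may be unbounded. Cutting with the ball brings every term within
     reach of [functional_sum], and changes nothing because [a k] vanishes outside the ball. *)
  pose u (x : V) := (\sum_(i < #|`sq|)
      sq`_i * \1_((a k @^-1` [set sq`_i]) `&` cball r) x)%R.
  have aE x : a k x = u x.
    rewrite /u; have [xr|xr] := pselect (cball r x).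
      rewrite [LHS]fimfunEord; apply: eq_bigr => i _; rewrite !indicE in_setI.
      by rewrite (mem_set xr) andbT.
    have [_ a_out _] := sa k; rewrite (a_out _ xr) [RHS]big1// => i _.
    by rewrite indicE memNset ?mulr0// => -[].
  have [//||_ H1 H2] := @functional_sum r _ (fun i : 'I_#|`sq| => sq`_i)%R
      (fun i => (a k @^-1` [set sq`_i]) `&` cball r)%R.
  - by move=> i; apply: measurableI => //; exact: measurable_cball.
  - by move=> i x [].
  split; first by under eq_fun do rewrite aE.
  have -> : L (a k) = L u by congr L; apply/funext => x; exact: aE.
  by rewrite [LHS]H2; apply: eq_integral => x _; rewrite aE.
have Xf := supported_X cK sf; have Xa k := supported_X cK (sa k).
have intD : \int[mu]_x (a k x * g x)%:E @[k --> \oo] --> \int[mu]_x (f x * g x)%:E.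
  have [|||||_ _ //] := @dominated_convergence _ _ _ mu _ measurableT
    (fun k x => (a k x * g x)%:E) (fun x => (f x * g x)%:E) (fun x => `|(f x * g x)%:E|).
  - by move=> k; apply/measurable_EFinP; exact: measurable_funM.
  - by apply/measurable_EFinP; exact: measurable_funM.
  - apply/nearW => x _; apply: cvg_EFin; first exact: nearW.
    by apply: cvgMl; exact: a_cvg.
  - exact: integrable_abse.
  - apply/nearW => x k _; rewrite !abse_EFin lee_fin !normrM ler_wpM2r//.
    by rewrite !ger0_norm.
have Ld : (L (a k))%:E @[k --> \oo] --> (L f)%:E.
  apply: cvg_EFin; first exact: nearW.
  apply/cvgrPdist_le => e e0 /=.
  have [d d0 H] := functional_small r e0.
  have mfa k : measurable_fun setT (fun x => f x - a k x)%R by exact: measurable_funB.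
  have mq k : measurable_fun setT (fun x => (`|f x - a k x| `^ q)%:E).
    exact: measurable_powR_norm.
  have cq : Lq_integral p (fun x => f x - a k x)%R @[k --> \oo] --> 0.
    have [|||||_ _ +] := @dominated_convergence _ _ _ mu _ measurableT
      (fun k x => (`|f x - a k x| `^ q)%:E) (cst 0) (fun x => (`|f x| `^ q)%:E).
    - exact: mq.
    - exact: measurable_cst.
    - apply/nearW => x _; apply: cvg_EFin; first exact: nearW.
      apply: (powR_norm_cvg0 q0); rewrite -[X in _ --> X](subrr (f x)).
      by apply: cvgB; [exact: cvg_cst|exact: a_cvg].
    - apply/integrableP; split.
        apply/measurable_EFinP; apply: (measurableT_comp (measurable_powR q)).
        exact: measurableT_comp.
      by under eq_integral do rewrite gee0_abs ?lee_fin ?powR_ge0//.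
    - apply/nearW => x k _; rewrite gee0_abs ?lee_fin ?powR_ge0//.
      rewrite ge0_ler_powR ?nnegrE ?(ltW q0)// !ger0_norm ?subr_ge0//.
      by rewrite lerBlDr lerDl.
    by rewrite integral0.
  move/fine_cvgP : cq => [cfin /cvgrPdist_le/(_ _ d0) cd].
  near=> k.
  have Xfa : L (fun x => f x - a k x)%R = (L f - L (a k))%R.
    rewrite -[in RHS](mulN1r (L _)) -functionalZ//.
    rewrite -functionalD//; last exact: predualZ.
    by congr L; apply/funext => x; rewrite mulN1r.
  rewrite -Xfa; apply: H.
    apply: (supported_Lq_dominated sf) => // x.
    by rewrite !ger0_norm ?subr_ge0// lerBlDr lerDl.
  rewrite -(@fineK _ (Lq_integral p _)); last by near: k.
  rewrite lee_fin (le_trans (ler_norm _))//.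
  rewrite -normrN -sub0r; near: k; exact: cd.
move: intD; under eq_fun do rewrite -(proj2 (La _)).
by move/cvg_lim => <-//; apply/esym/cvg_lim.
Unshelve. all: by end_near. Qed.

Lemma functional_represented r f : supported_Lq p (cball r) f ->
  mu.-integrable setT (fun x => (f x * g x)%:E) ->
  (L f)%:E = \int[mu]_x (f x * g x)%:E.
Proof.
move=> sf ifg; have cK := @compact_cball R n r; have [mf _ _] := sf.
pose fp x := Num.max (f x) 0%R; pose fn x := Num.max (- f x)%R 0%R.
have fE x : f x = (fp x + -1 * fn x)%R.
  rewrite /fp /fn; case: (leP (f x) 0%R) => h; case: (leP (- f x)%R 0%R); lra.
have mfp : measurable_fun setT fp by exact: measurable_maxr.
have mfn : measurable_fun setT fn by apply: measurable_maxr => //; exact: measurable_funN.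
have fp0 x : (0 <= fp x)%R by rewrite le_max lexx orbT.
have fn0 x : (0 <= fn x)%R by rewrite le_max lexx orbT.
have fpf x : (`|fp x| <= `|f x|)%R.
  by rewrite (ger0_norm (fp0 x)) /fp ge_max normr_ge0 ler_norm.
have fnf x : (`|fn x| <= `|f x|)%R.
  by rewrite (ger0_norm (fn0 x)) /fn ge_max normr_ge0 -normrN ler_norm.
have sfp := supported_Lq_dominated sf mfp fpf.
have sfn := supported_Lq_dominated sf mfn fnf.
have idom h : measurable_fun setT h -> (forall x, `|h x| <= `|f x|)%R ->
    mu.-integrable setT (fun x => (h x * g x)%:E).
  move=> mh hf; apply: le_integrable ifg => //.
    by apply/measurable_EFinP; exact: measurable_funM.
  by move=> x _; rewrite !abse_EFin lee_fin !normrM ler_wpM2r.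
have ip := idom _ mfp fpf; have inn := idom _ mfn fnf.
have Xp := supported_X cK sfp; have Xn := supported_X cK sfn.
have -> : f = (fun x => fp x + -1 * fn x)%R by apply/funext.
rewrite functionalD//; last exact: predualZ.
rewrite functionalZ// EFinD EFinM (functional_ge0 fp0 sfp ip) (functional_ge0 fn0 sfn inn).
rewrite -integralZl// -integralD//; last exact: integrableZl.
by apply: eq_integral => x _; rewrite -EFinM -EFinD; congr EFin; ring.
Qed.

(** [predual_test] asks for a finite integral, which holds on the part of [K] where |g| <= k. The
    bound it returns is independent of k, and monotone convergence gives it on [K]. *)
Lemma represented_M_bound : M_bound G s p C g.
Proof.
move=> K cK; have mK := compact_measurable_rV cK.
pose A k := K `&` (fun x => `|g x|%R) @^-1` `]-oo, k%:R].
have mng : measurable_fun setT (fun x => `|g x|%R) by exact: measurableT_comp.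
have mA k : measurable (A k).
  by apply: measurableI => //; rewrite -[X in measurable X]setTI; exact: mng.
have mgp := @measurable_powR_norm R n p g setT mg.
have AT : \bigcup_k A k = K.
  apply/seteqP; split => [x [k _ []]//|x Kx]; exists (Num.truncn `|g x|%R).+1 => //.
  by split => //=; rewrite in_itv/= ltW// truncnS_gt.
have c : \int[mu]_(x in A k) (`|g x| `^ p)%:E @[k --> \oo] --> \int[mu]_(x in K) (`|g x| `^ p)%:E.
  rewrite -AT; apply: ge0_nondecreasing_set_cvg_integral => //.
  - move=> i j ij; apply/subsetPset; apply: setIS => x /=; rewrite !in_itv/=.
    by move/le_trans; apply; rewrite ler_nat.
  - by move=> k; exact: measurable_funTS.
apply: (cvge_to_le c); apply/nearW => k.
apply: (predual_test p1 cap_lty cap_eq0 XN (ltW C0) mg cK (mA k)).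
- by move=> x [].
- apply: (@le_lt_trans _ _ (\int[mu]_(x in A k) (cst (k%:R `^ p)%:E) x)).
    apply: ge0_le_integral => //.
    + exact: measurable_funTS.
    + move=> x [_] /=; rewrite in_itv/= => gk.
      by rewrite lee_fin ge0_ler_powR ?nnegrE ?(ltW p0).
  rewrite integral_cst// lte_mul_pinfty ?lee_fin ?powR_ge0//.
  apply: le_lt_trans (compact_measure_lty cK).
  by apply: le_measure; rewrite ?inE//; move=> x [].
- move=> f sf Nf ifg; have [r [_ Kr]] := compact_subset_cball cK.
  rewrite -(functional_represented (supported_LqS Kr sf) ifg).
  apply: (@le_trans _ _ `|L f|%:E); first by rewrite lee_fin ler_norm.
  apply: le_trans (L_bound (supported_X cK sf)) _.
  by rewrite -[leRHS]mule1 lee_wpmul2l// lee_fin (ltW C0).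
Qed.

(** [L] and the pairing with [g] agree on compactly supported L^q functions, and both are bounded by
    [C] times the norm. On the approximation error each contributes at most e/2. *)
Lemma functional_pairing f : X f -> L f = pairing g f.
Proof.
move=> Xf; have gb := represented_M_bound.
have ifg := predual_integrable XN Xf mg C0 gb.
apply/eqP; rewrite -subr_eq0 -normr_le0; apply/ler_addgt0Pr => e e0; rewrite add0r.
have C20 : (0 < e / (2 * C))%R by rewrite divr_gt0// mulr_gt0.
have [K [h [cK sh Nh]]] := predual_approx XN Xf C20.
have Xh := supported_X cK sh.
have ihg := predual_integrable XN Xh mg C0 gb.
have [r [_ Kr]] := compact_subset_cball cK.
have Lh := functional_represented (supported_LqS Kr sh) ihg.
pose d x := (-1 * h x + f x)%R.
have Xd : X d by exact: (predual_lin XN).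
have idg := predual_integrable XN Xd mg C0 gb.
have LfE : L f = (L h + L d)%R by rewrite /d L_lin//; ring.
have Pd : pairing g f = (pairing g h + pairing g d)%R.
  rewrite /pairing -RintegralD//; apply: eq_Rintegral => x _; rewrite /d; ring.
have -> : (L f - pairing g f = L d - pairing g d)%R.
  rewrite LfE Pd; have -> : L h = pairing g h by rewrite /pairing /Rintegral -Lh.
  ring.
have half_bound : C%:E * N d <= (e / 2)%:E.
  apply: (@le_trans _ _ (C%:E * (e / (2 * C))%:E)).
    by rewrite lee_wpmul2l ?lee_fin ?(ltW C0).
  rewrite -EFinM lee_fin le_eqVlt; apply/orP; left; apply/eqP; field.
  by rewrite gt_eqF.
rewrite (le_trans (ler_normB _ _))// [leRHS]splitr lerD//.
  by rewrite -lee_fin; exact: le_trans (L_bound Xd) _.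
rewrite -lee_fin /pairing EFin_normr_Rintegral//.
apply: (le_trans (le_abse_integral _ _ _)) => //.
  exact: measurable_int idg.
apply: (le_trans (predual_hoelder XN Xd mg C0 gb)).
exact: half_bound.
Qed.

End extension.

End representation.

(** * The isometric duality for an abstract predual *)

Section predual_duality.
Context {R : realType} {n : nat}.
Local Notation V := 'rV[R]_n.
Local Notation mu := (lebesgue_rV n).
Local Open Scope ereal_scope.
Implicit Types (f g h : V -> R) (K A S D : set V) (c e r : R).
Variables (G : V -> R) (s p : R).
Hypothesis p1 : (1 < p)%R.
Local Notation cap := (bessel_cap G s).
Hypothesis cap_lty : forall E : set V, bounded_set E -> cap E < +oo.
Hypothesis cap_eq0 : forall K : set V, measurable K -> cap K = 0 -> mu K = 0.
Variables (X : set (V -> R)) (N : (V -> R) -> \bar R).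
Hypothesis XN : predual G s p X N.

Let p0 : (0 < p)%R. Proof. exact: lt_trans p1. Qed.
Local Notation M := (M_space G s p).
Local Notation NM := (M_norm G s p).

Lemma M_predual_integrable f g : M g -> X f -> mu.-integrable setT (fun x => (f x * g x)%:E).
Proof.
move=> /(M_spaceP p1 cap_lty cap_eq0)[mg [c c0 gc]] Xf.
exact: (predual_integrable XN Xf mg c0 gc).
Qed.

Lemma norm_pairing_le f g c : measurable_fun setT g -> (0 < c)%R ->
  M_bound G s p c g -> X f -> `|pairing g f|%:E <= c%:E * N f.
Proof.
move=> mg c0 gc Xf; have ifg := predual_integrable XN Xf mg c0 gc.
rewrite /pairing EFin_normr_Rintegral//.
apply: (le_trans (le_abse_integral _ _ _)) => //; first exact: measurable_int ifg.
exact: (predual_hoelder XN Xf mg c0 gc).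
Qed.

Lemma M_predual_pairing_lin (k : R) g h f : M g -> M h -> X f ->
  pairing (fun x => k * g x + h x)%R f = (k * pairing g f + pairing h f)%R.
Proof.
move=> Mg Mh Xf; have ig := M_predual_integrable Mg Xf; have ih := M_predual_integrable Mh Xf.
rewrite /pairing -RintegralZl// -RintegralD//; last exact: (integrableZl measurableT k ig).
by apply: eq_Rintegral => x _; ring.
Qed.

(** The source of uniqueness: |g|^p has integral 0 on each ball, and countably many balls cover the
    space. *)
Lemma M_ae_eq0 g : measurable_fun setT g -> M_bound G s p 0 g -> g = cst 0%R %[ae mu].
Proof.
move=> mg g0.
have gk (k : nat) : {ae mu, forall x, cball k%:R x -> g x = 0%R}.
  have mk := @measurable_cball R n k%:R.
  have mgp := @measurable_powR_norm R n p g (cball k%:R) mg.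
  have : \int[mu]_(x in cball k%:R) `|(`|g x| `^ p)%:E| = 0.
    apply/eqP; rewrite eq_le integral_ge0 ?andbT//.
    under eq_integral do rewrite gee0_abs ?lee_fin ?powR_ge0//.
    by apply: le_trans (g0 _ (@compact_cball R n k%:R)) _; rewrite powR0 ?gt_eqF// mul0e.
  move/(ae_eq_integral_abs mu mk mgp); apply: filterS => x H xk.
  have /= [/powR_eq0_eq0/eqP] := H xk.
  by rewrite normr_eq0 => /eqP.
have : {ae mu, forall x, forall k : nat, cball k%:R x -> g x = 0%R}.
  exact/ae_foralln.
apply: filterS => x H _.
by have : setT x by []; rewrite -bigcup_cball => -[k _ /H].
Qed.

Lemma M_norm_le_dual_norm g : M g -> NM g <= dual_norm X N (pairing g).
Proof.
move=> Mg; have [mg [c c0 gc]] := (M_spaceP p1 cap_lty cap_eq0 g).1 Mg.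
have Dc : dual_norm X N (pairing g) <= c%:E.
  apply: ub_ereal_sup => _ [f [Xf Nf] <-].
  apply: le_trans (norm_pairing_le mg c0 gc Xf) _.
  by rewrite -[leRHS]mule1 lee_wpmul2l// lee_fin (ltW c0).
have X0 := predual0 p1 XN.
(* The zero function is admissible in the supremum, so the dual norm is not -oo. *)
have N0 : N (fun=> 0%R) <= 1.
  have [s0 L0] := supported_Lq0 p1 (@cball R n 0%R).
  have [_] := predual_atom XN (@compact_cball R n 0%R) s0.
  by rewrite L0 poweR0r ?invr_neq0 ?gt_eqF ?conj_gt0// mul0e => /le_trans; apply.
have D0 : 0 <= dual_norm X N (pairing g).
  by apply: ereal_sup_ge; exists `|pairing g (fun=> 0%R)|%:E => //; exists (fun=> 0%R).
have fD : dual_norm X N (pairing g) \is a fin_num.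
  by rewrite ge0_fin_numE// (le_lt_trans Dc)// ltry.
rewrite -(fineK fD); set d := fine _.
have d0 : (0 <= d)%R by exact: fine_ge0.
apply/(M_normP p1 cap_lty cap_eq0 mg d0) => K cK.
apply: (predual_test p1 cap_lty cap_eq0 XN d0 mg cK (compact_measurable_rV cK)) => //.
  by have [_ + _] := Mg; exact.
move=> f sf Nf ifg; have [Xf _] := predual_atom XN cK sf.
rewrite -[leLHS]fineK ?integrable_fin_num// -[X in X%:E]/(pairing g f).
apply: (@le_trans _ _ `|pairing g f|%:E); first by rewrite lee_fin ler_norm.
by rewrite /d fineK//; apply: ereal_sup_ubound; exists f.
Qed.

Lemma dual_norm_le_M_norm g : M g -> dual_norm X N (pairing g) <= NM g.
Proof.
move=> Mg; have [mg [c c0 gc]] := (M_spaceP p1 cap_lty cap_eq0 g).1 Mg.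
apply: ub_ereal_sup => _ [f [Xf Nf] <-].
have NM0 := M_norm_ge0 p cap_eq0 g.
have fN : NM g \is a fin_num by rewrite ge0_fin_numE//; case: Mg.
(* [norm_pairing_le] takes a positive constant, while the norm of [g] can be 0. *)
apply/lee_addgt0Pr => e e0; rewrite -(fineK fN) -EFinD.
set d := (_ + e)%R; have d0 : (0 < d)%R by rewrite ltr_wpDl// fine_ge0.
have gd : M_bound G s p d g.
  apply/(M_normP p1 cap_lty cap_eq0 mg (ltW d0)).
  by rewrite /d EFinD fineK// leeDl// lee_fin ltW.
apply: le_trans (norm_pairing_le mg d0 gd Xf) _.
by rewrite -[leRHS]mule1 lee_wpmul2l// lee_fin (ltW d0).
Qed.

Theorem predual_dual_isometric : dual_isometric X N M NM.
Proof.
split.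
- by move=> g f Mg Xf; exact: M_predual_integrable.
- move=> k g h Mg Mh; split; first exact: M_space_lin.
  by move=> f Xf; exact: M_predual_pairing_lin.
- move=> g Mg; split; last first.
    by apply/eqP; rewrite eq_le dual_norm_le_M_norm// M_norm_le_dual_norm.
  have [mg [c c0 gc]] := (M_spaceP p1 cap_lty cap_eq0 g).1 Mg.
  split; last by exists c => f Xf; exact: norm_pairing_le.
  move=> k f h Xf Xh; have iff := M_predual_integrable Mg Xf; have ih := M_predual_integrable Mg Xh.
  rewrite /pairing -RintegralZl// -RintegralD//; last exact: (integrableZl measurableT k iff).
  by apply: eq_Rintegral => x _; ring.
- move=> L [Llin [C LC]].
  (* The constant provided by [dual_space] can be nonpositive. *)
  pose C' := (Num.max C 1)%R; have C'0 : (0 < C')%R by rewrite lt_max ltr01 orbT.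
  have LC' f : X f -> `|L f|%:E <= C'%:E * N f.
    move=> Xf; apply: le_trans (LC _ Xf) _; rewrite lee_wpmul2r ?(predual_norm_ge0 XN)//.
    by rewrite lee_fin le_max lexx.
  have [g mg gE] := functional_global_density p1 cap_lty XN Llin C'0 LC'.
  exists g.
    apply/(M_spaceP p1 cap_lty cap_eq0); split => //; exists C' => //.
    exact: (represented_M_bound p1 cap_lty cap_eq0 XN Llin C'0 LC' mg gE).
  exact: (functional_pairing p1 cap_lty cap_eq0 XN Llin C'0 LC' mg gE).
- move=> g h Mg Mh gh.
  have Md := M_space_lin p1 cap_lty cap_eq0 (-1)%R Mh Mg.
  have [md _ _] := Md.
  have D0 : dual_norm X N (pairing (fun x => -1 * h x + g x)%R) <= 0.
    apply: ub_ereal_sup => _ [f [Xf _] <-].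
    by rewrite M_predual_pairing_lin// (gh _ Xf) mulN1r addNr normr0.
  have NM0 := le_trans (M_norm_le_dual_norm Md) D0.
  have /(M_ae_eq0 md) : M_bound G s p 0 (fun x => -1 * h x + g x)%R.
    exact/(M_normP p1 cap_lty cap_eq0 md (lexx 0%R)).
  by apply: filterS => x /(_ I); rewrite /= => H _; lra.
Qed.

End predual_duality.

(** * The Koethe dual of M *)

Section kothe.
Context {R : realType} {n : nat}.
Local Notation V := 'rV[R]_n.
Local Notation mu := (lebesgue_rV n).
Local Open Scope ereal_scope.
Implicit Types (f g h : V -> R) (K A S D : set V) (c e r : R).
Variables (G : V -> R) (s p : R).
Hypothesis p1 : (1 < p)%R.
Local Notation cap := (bessel_cap G s).
Hypothesis cap_lty : forall E : set V, bounded_set E -> cap E < +oo.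
Hypothesis cap_eq0 : forall K : set V, measurable K -> cap K = 0 -> mu K = 0.
Local Notation q := (p / (p - 1))%R.
Local Notation M := (M_space G s p).
Local Notation NM := (M_norm G s p).

Let p0 : (0 < p)%R. Proof. exact: lt_trans p1. Qed.
Let q0 : (0 < q)%R. Proof. exact: conj_gt0. Qed.

Lemma Lnorm_powR r f : 'N[mu]_r%:E[EFin \o f] =
  (\int[mu]_x (`|f x| `^ r)%:E) `^ r^-1.
Proof. by rewrite unlock. Qed.

(** Hölder's inequality for [f] and the restriction of [g] to [A]. Vanishing outside [A] is asked
    a.e., which is the information that blocks carry. *)
Lemma hoelder_on A f g : measurable A -> measurable_fun setT f ->
  measurable_fun setT g -> {ae mu, forall x, ~ A x -> f x = 0%R} ->
  \int[mu]_x `|f x * g x|%:E <=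
  Lq_integral p f `^ q^-1 * (\int[mu]_(x in A) (`|g x| `^ p)%:E) `^ p^-1.
Proof.
move=> mA mf mg f0.
have mgA : measurable_fun setT (g \_ A)%R.
  by apply/(measurable_restrictT g mA); exact: measurable_funTS.
have fgA : \int[mu]_x `|f x * g x|%:E = \int[mu]_x `|f x * (g \_ A)%R x|%:E.
  apply: ge0_ae_eq_integral => //.
  - by apply/measurable_EFinP; apply: measurableT_comp => //; exact: measurable_funM.
  - by apply/measurable_EFinP; apply: measurableT_comp => //; exact: measurable_funM.
  - apply: filterS f0 => x fx _; rewrite /= patchE.
    by case: ifPn => // /negP; rewrite inE => /fx ->; rewrite !mul0r.
have := @hoelder _ _ _ mu f (g \_ A)%R q p mf mgA q0 p0.
rewrite addrC conj_sum// => /(_ erefl); rewrite Lnorm1 -fgA.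
have gAE : \int[mu]_x (`|(g \_ A)%R x| `^ p)%:E = \int[mu]_(x in A) (`|g x| `^ p)%:E.
  rewrite [RHS]integral_mkcond; apply: eq_integral => x _; rewrite !patchE.
  by case: ifPn => // _; rewrite normr0 powR0// gt_eqF.
by rewrite !Lnorm_powR gAE.
Qed.

Lemma unit_ballP g : M g /\ NM g <= 1 <-> measurable_fun setT g /\ M_bound G s p 1 g.
Proof.
split=> [[[mg _ _] /(M_normP p1 cap_lty cap_eq0 mg ler01)]//|[mg gb]].
split; last exact/(M_normP p1 cap_lty cap_eq0 mg ler01).
by apply/(M_spaceP p1 cap_lty cap_eq0); split => //; exists 1%R.
Qed.

Lemma kothe_norm_ubound f g : measurable_fun setT g -> M_bound G s p 1 g ->
  \int[mu]_x `|f x * g x|%:E <= kothe_norm M NM f.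
Proof.
by move=> mg gb; apply: ereal_sup_ubound; exists g => //; apply/unit_ballP.
Qed.

Lemma kothe_norm_le f (C : \bar R) :
  (forall g, measurable_fun setT g -> M_bound G s p 1 g ->
    \int[mu]_x `|f x * g x|%:E <= C) -> kothe_norm M NM f <= C.
Proof.
by move=> H; apply: ub_ereal_sup => _ [g /unit_ballP[mg gb] <-]; exact: H.
Qed.

Lemma M_bound0 c : M_bound G s p c (fun=> 0%R).
Proof.
move=> K cK; under eq_integral do rewrite normr0 powR0 ?gt_eqF//.
by rewrite integral0 mule_ge0 ?lee_fin ?powR_ge0// bessel_cap_ge0.
Qed.

Lemma kothe_norm_ge0 f : 0 <= kothe_norm M NM f.
Proof.
apply: le_trans (@kothe_norm_ubound f (fun=> 0%R) _ (@M_bound0 _)) => //.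
exact: integral_ge0.
Qed.

Lemma M_boundZ c d g : (0 < d)%R -> M_bound G s p c g -> (0 <= c)%R ->
  measurable_fun setT g -> M_bound G s p (d * c) (fun x => d * g x)%R.
Proof.
move=> d0 gc c0 mg K cK; have mK := compact_measurable_rV cK.
have mgp := @measurable_powR_norm R n p g K mg.
under eq_integral do rewrite normrM powRM// (ger0_norm (ltW d0)) EFinM.
rewrite ge0_integralZl// ?lee_fin ?powR_ge0//.
by rewrite powRM ?(ltW d0)// EFinM -muleA lee_wpmul2l ?lee_fin ?powR_ge0//; exact: gc.
Qed.

Lemma kothe_hoelder f g c : measurable_fun setT f -> measurable_fun setT g ->
  (0 < c)%R -> M_bound G s p c g ->
  \int[mu]_x `|f x * g x|%:E <= c%:E * kothe_norm M NM f.
Proof.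
move=> mf mg c0 gc.
have mcg : measurable_fun setT (fun x => c^-1 * g x)%R by exact: measurable_funM.
have gb : M_bound G s p 1 (fun x => c^-1 * g x)%R.
  have <- : (c^-1 * c = 1)%R by rewrite mulVf// gt_eqF.
  apply: M_boundZ => //; last exact: ltW.
  by rewrite invr_gt0.
have -> : \int[mu]_x `|f x * g x|%:E = c%:E * \int[mu]_x `|f x * (c^-1 * g x)|%:E.
  rewrite -ge0_integralZl//; last 2 first.
  - by apply/measurable_EFinP; apply: measurableT_comp => //; exact: measurable_funM.
  - by rewrite lee_fin ltW.
  apply: eq_integral => x _; rewrite -EFinM mulrCA [in RHS]normrM ger0_norm ?invr_ge0 ?(ltW c0)//.
  by rewrite mulrA mulfV ?mul1r// gt_eqF.
by rewrite lee_wpmul2l ?lee_fin ?(ltW c0)//; exact: kothe_norm_ubound.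
Qed.

Lemma kothe_norm_lin (k : R) f h : measurable_fun setT f -> measurable_fun setT h ->
  kothe_norm M NM (fun x => k * f x + h x)%R <=
  `|k|%:E * kothe_norm M NM f + kothe_norm M NM h.
Proof.
move=> mf mh; apply: kothe_norm_le => g mg gb.
have mfg : measurable_fun setT (fun x => `|f x * g x|%:E).
  by apply/measurable_EFinP; apply: measurableT_comp => //; exact: measurable_funM.
have mhg : measurable_fun setT (fun x => `|h x * g x|%:E).
  by apply/measurable_EFinP; apply: measurableT_comp => //; exact: measurable_funM.
apply: (@le_trans _ _ (\int[mu]_x (`|k|%:E * `|f x * g x|%:E + `|h x * g x|%:E))).
  apply: ge0_le_integral => //.
  - apply/measurable_EFinP; apply: measurableT_comp => //; apply: measurable_funM => //.
    by apply: measurable_funD => //; exact: measurable_funM.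
  - by apply: emeasurable_funD => //; exact: emeasurable_funM.
  - move=> x _; rewrite -EFinM -EFinD lee_fin -normrM.
    by rewrite (le_trans _ (ler_normD _ _))// mulrDl mulrA.
rewrite ge0_integralD//; last exact: emeasurable_funM.
rewrite ge0_integralZl// leeD//; last exact: kothe_norm_ubound.
by rewrite lee_wpmul2l//; exact: kothe_norm_ubound.
Qed.

Lemma kothe_norm_supported K f : compact K -> supported_Lq p K f ->
  kothe_norm M NM f <= Lq_integral p f `^ q^-1 * cap K `^ p^-1.
Proof.
move=> cK [mf f0 foo]; apply: kothe_norm_le => g mg gb.
have mK := compact_measurable_rV cK.
have f0ae : {ae mu, forall x, ~ K x -> f x = 0%R} by apply/nearW => x; exact: f0.
apply: (le_trans (hoelder_on mK mf mg f0ae)).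
rewrite lee_wpmul2l ?poweR_ge0//; apply: gt0_ler_poweR.
- by rewrite invr_ge0 ltW.
- by rewrite in_itv/= leey andbT; apply: integral_ge0 => x _; rewrite lee_fin powR_ge0.
- by rewrite in_itv/= leey andbT bessel_cap_ge0.
- by have := gb K cK; rewrite powR1 mul1e.
Qed.

Lemma measurable_splice A g g1 t : measurable A -> measurable_fun setT g ->
  measurable_fun setT g1 ->
  measurable_fun setT (fun x => if x \in A then (1 - t `^ p) * g x else t * g1 x)%R.
Proof.
move=> mA mg mg1; apply: measurable_fun_ifT; [|exact: measurable_funM..].
apply: (@measurable_fun_bool _ _ _ _ true); rewrite setTI (_ : _ @^-1` _ = A)//.
by apply/seteqP; split => x /= => [/set_mem|/mem_set].
Qed.

(** On [A] the p-th power of the spliced function is at most (1 - t^p) |g|^p, because (1 - t^p)^p <=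
    1 - t^p; off [A] it is t^p |g1|^p. The two weights add up to 1. *)
Lemma M_bound_splice A g g1 t : measurable A -> measurable_fun setT g ->
  measurable_fun setT g1 -> (0 <= t <= 1)%R ->
  M_bound G s p 1 g -> M_bound G s p 1 g1 ->
  M_bound G s p 1 (fun x => if x \in A then (1 - t `^ p) * g x else t * g1 x)%R.
Proof.
move=> mA mg mg1 /andP[t0 t1] gb g1b K cK; have mK := compact_measurable_rV cK.
have tp1 : (t `^ p <= 1)%R.
  have /= <- : (1 `^ p = 1 :> R)%R by rewrite powR1.
  by rewrite ge0_ler_powR ?nnegrE ?(ltW p0).
have tp0 : (0 <= 1 - t `^ p)%R by rewrite subr_ge0.
have mgp := @measurable_powR_norm R n p g K mg.
have mg1p := @measurable_powR_norm R n p g1 K mg1.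
apply: (@le_trans _ _ (\int[mu]_(x in K)
    ((1 - t `^ p)%:E * (`|g x| `^ p)%:E + (t `^ p)%:E * (`|g1 x| `^ p)%:E))).
  apply: ge0_le_integral => //.
  - exact: (@measurable_powR_norm R n p _ K (measurable_splice t mA mg mg1)).
  - by apply: emeasurable_funD; apply: emeasurable_funM.
  - move=> x _; rewrite -!EFinM -EFinD lee_fin; case: ifPn => _.
      rewrite normrM powRM// (ger0_norm tp0) ler_wpDr ?mulr_ge0 ?powR_ge0//.
      rewrite ler_wpM2r ?powR_ge0//.
      have [->|n0] := eqVneq (1 - t `^ p)%R 0%R; first by rewrite powR0// gt_eqF.
      by apply: ge1r_powR; rewrite ?(ltW p1)// lt0r n0 tp0/= lerBlDr lerDl powR_ge0.
    by rewrite normrM powRM// (ger0_norm t0) ler_wpDl// mulr_ge0 ?powR_ge0.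
rewrite ge0_integralD//; last 4 first.
- by move=> x _; rewrite -EFinM lee_fin mulr_ge0 ?powR_ge0.
- exact: emeasurable_funM.
- by move=> x _; rewrite -EFinM lee_fin mulr_ge0 ?powR_ge0.
- exact: emeasurable_funM.
rewrite ge0_integralZl// ?lee_fin// ge0_integralZl// ?lee_fin ?powR_ge0//.
have gK := gb K cK; have g1K := g1b K cK; rewrite powR1 mul1e in gK g1K *.
apply: (@le_trans _ _ ((1 - t `^ p)%:E * cap K + (t `^ p)%:E * cap K)).
  apply: leeD; apply: lee_wpmul2l; [by rewrite lee_fin|exact: gK|by rewrite lee_fin powR_ge0|].
  exact: g1K.
by rewrite -ge0_muleDl ?lee_fin ?powR_ge0// -EFinD subrK mul1e.
Qed.

(* The norm of the Koethe dual is absolutely continuous because M is p-convex: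
   for [0 <= t <= 1], the function t g1 1_(~ A) + (1 - t^p) g 1_A stays in the
   unit ball of M. Testing [f] against it bounds the mass of f g1 outside [A] as
   soon as [g] nearly attains the norm of [f] on [A]. *)
Lemma kothe_approx f e : measurable_fun setT f -> kothe_norm M NM f < +oo ->
  (0 < e)%R -> exists K h, [/\ compact K, supported_Lq p K h &
    kothe_norm M NM (fun x => -1 * h x + f x)%R <= e%:E].
Proof.
move=> mf foo e0; have N0 := kothe_norm_ge0 f.
have fN : kothe_norm M NM f \is a fin_num by rewrite ge0_fin_numE.
pose N := fine (kothe_norm M NM f).
have NE : kothe_norm M NM f = N%:E by rewrite fineK.
have N0' : (0 <= N)%R by exact: fine_ge0.
have pm1 : (0 < p - 1)%R by rewrite subr_gt0.
(* The mass I of f g1 outside the set will satisfy I <= N t^(p - 1) + d / t. With u = t^(p - 1) the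
   first term is at most e/2, and d = t e / 4 makes the second one e/4. *)
pose u := (Num.min 1 (e / (2 * (N + 1))))%R.
have N10 : (0 < 2 * (N + 1))%R by rewrite mulr_gt0// ltr_wpDl.
have u0 : (0 < u)%R by rewrite lt_min ltr01/= divr_gt0.
have u1 : (u <= 1)%R by rewrite ge_min lexx.
have Nu : (N * u <= e / 2)%R.
  apply: (@le_trans _ _ (N * (e / (2 * (N + 1))))%R).
    by rewrite ler_wpM2l// ge_min lexx orbT.
  rewrite mulrA ler_pdivrMr// [leRHS](_ : _ = N * e + e)%R; last by field.
  by rewrite lerDl ltW.
pose t := (u `^ (p - 1)^-1)%R.
have t0 : (0 < t)%R by exact: powR_gt0.
have t1 : (t <= 1)%R.
  have /= <- : (1 `^ (p - 1)^-1 = 1 :> R)%R by rewrite powR1.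
  by rewrite ge0_ler_powR ?nnegrE ?invr_ge0 ?(ltW pm1)// ltW.
have tpE : (t `^ p = t * u)%R.
  rewrite -(mulr_powRB1 (ltW t0) p0); congr (_ * _)%R.
  by rewrite /t -powRrM mulVf ?gt_eqF// powRr1// ltW.
have tp0 : (0 <= t `^ p)%R by exact: powR_ge0.
have tp1 : (t `^ p <= 1)%R by rewrite tpE mulr_ile1 ?(ltW t0) ?(ltW u0).
pose d := (t * e / 4)%R.
have d0 : (0 < d)%R by rewrite divr_gt0// mulr_gt0.
have [g [mg gb gN]] : exists g, [/\ measurable_fun setT g, M_bound G s p 1 g &
    (N - d)%:E < \int[mu]_x `|f x * g x|%:E].
  have : (N - d)%:E < kothe_norm M NM f by rewrite NE lte_fin ltrBlDr ltrDl.
  by move=> /ereal_sup_gt[_ [g /unit_ballP[mg gb] <-] H]; exists g.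
have mfg (g' : V -> R) : measurable_fun setT g' -> measurable_fun setT (fun x => `|f x * g' x|%:E).
  by move=> mg'; apply/measurable_EFinP; apply: measurableT_comp => //; exact: measurable_funM.
have mnf : measurable_fun setT (fun x => `|f x|%R) by exact: measurableT_comp.
(* Cutting both in space and in the values of [f] makes the restriction of [f] bounded with bounded
   support, hence in L^q. *)
pose A k := cball k%:R `&` (fun x => `|f x|%R) @^-1` `]-oo, k%:R].
have mA k : measurable (A k).
  apply: measurableI; first exact: measurable_cball.
  by rewrite -[X in measurable X]setTI; exact: mnf.
have ndA : nondecreasing_seq A.
  move=> i j ij; apply/subsetPset; apply: setISS; first exact/subsetPset/nondecreasing_cball.
  by move=> x /=; rewrite !in_itv/= => /le_trans; apply; rewrite ler_nat.
have AT : \bigcup_k A k = setT.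
  rewrite -subTset => x _; exists (Num.truncn (Num.max `|x| `|f x|)%R).+1 => //.
  have := truncnS_gt (Num.max `|x| `|f x|)%R; rewrite gt_max => /andP[x1 x2].
  by split; rewrite /cball /= ?in_itv/= ltW.
have [k Ak] : exists k, (N - d)%:E < \int[mu]_(x in A k) `|f x * g x|%:E.
  have c : \int[mu]_(x in A k) `|f x * g x|%:E @[k --> \oo] --> \int[mu]_x `|f x * g x|%:E.
    rewrite -AT; apply: ge0_nondecreasing_set_cvg_integral => //.
    by move=> k; apply: measurable_funTS; exact: mfg.
  apply: contrapT => /forallNP H.
  have : \int[mu]_x `|f x * g x|%:E <= (N - d)%:E.
    by apply: (cvge_to_le c); apply/nearW => k; rewrite leNgt; apply/negP; exact: H.
  by rewrite leNgt gN.
pose h x := (f x * \1_(A k) x)%R.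
have sh : supported_Lq p (cball k%:R) h.
  split.
  - by apply: measurable_funM => //; exact: measurable_indic.
  - by move=> x nx; rewrite /h indicE memNset ?mulr0// => -[].
  - rewrite /Lq_integral (_ : integral _ _ _ = \int[mu]_(x in A k) (`|f x| `^ q)%:E); last first.
      rewrite [RHS]integral_mkcond; apply: eq_integral => x _.
      rewrite patchE /h indicE; case: (x \in A k); rewrite ?mulr1// mulr0 normr0.
      by rewrite powR0// gt_eqF.
    apply: (@le_lt_trans _ _ (\int[mu]_(x in A k) (cst (k%:R `^ q)%:E) x)).
      apply: ge0_le_integral => //.
      + apply: measurable_funTS; apply/measurable_EFinP.
        exact: (measurableT_comp (measurable_powR q)).
      + move=> x [_] /=; rewrite in_itv/= => fk.
        by rewrite lee_fin ge0_ler_powR ?nnegrE ?(ltW q0).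
    rewrite integral_cst// lte_mul_pinfty ?lee_fin ?powR_ge0//.
    apply: le_lt_trans (lebesgue_rV_cball_lty n k%:R).
    apply: le_measure; rewrite ?inE//; first exact: measurable_cball.
    by move=> x [].
exists (cball k%:R), h; split => //; first exact: compact_cball.
apply: kothe_norm_le => g1 mg1 g1b.
pose I := \int[mu]_(x in ~` A k) `|f x * g1 x|%:E.
have -> : \int[mu]_x `|(-1 * h x + f x) * g1 x|%:E = I.
  rewrite [RHS]integral_mkcond; apply: eq_integral => x _.
  rewrite patchE /h indicE in_setC; case: (x \in A k) => /=.
    by rewrite mulr1 mulN1r addNr mul0r normr0.
  by rewrite mulr0 mulr0 add0r.
pose w x := (if x \in A k then (1 - t `^ p) * g x else t * g1 x)%R.
have t01 : (0 <= t <= 1)%R by rewrite (ltW t0).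
have wb := M_bound_splice (mA k) mg mg1 t01 gb g1b.
have mw := measurable_splice t (mA k) mg mg1.
have := kothe_norm_ubound f mw wb; rewrite NE.
have mCA : measurable (~` A k) by exact: measurableC.
rewrite -(setUv (A k)) ge0_integral_setU//; last 2 first.
- by rewrite setUv; exact: mfg.
- by apply/disj_setPS; rewrite setICr.
have -> : \int[mu]_(x in A k) `|f x * (if x \in A k then (1 - t `^ p) * g x else t * g1 x)|%:E =
    (1 - t `^ p)%:E * \int[mu]_(x in A k) `|f x * g x|%:E.
  rewrite -ge0_integralZl//; last 2 first.
  - by apply: measurable_funTS; exact: mfg.
  - by rewrite lee_fin subr_ge0.
  apply: eq_integral => x xA; rewrite xA mulrCA normrM ger0_norm ?subr_ge0//.
have -> : \int[mu]_(x in ~` A k) `|f x * (if x \in A k then (1 - t `^ p) * g x else t * g1 x)|%:E =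
    t%:E * I.
  rewrite -ge0_integralZl//; last 2 first.
  - by apply: measurable_funTS; exact: mfg.
  - by rewrite lee_fin ltW.
  apply: eq_integral => x; rewrite in_setC => /negbTE ->.
  by rewrite mulrCA normrM ger0_norm ?(ltW t0).
move=> H.
have {}H : (1 - t `^ p)%:E * (N - d)%:E + t%:E * I <= N%:E.
  apply: le_trans H; rewrite leeD2r// lee_wpmul2l ?lee_fin ?subr_ge0//.
  exact: ltW.
have I0 : 0 <= I by exact: integral_ge0.
case: I I0 H => [i| |]//.
  rewrite -!EFinM -EFinD !lee_fin => i0 H; rewrite tpE in H tp1.
  have : (t * i <= t * e)%R.
    have : (t * (N * u) <= t * (e / 2))%R by rewrite ler_pM2l.
    have : (0 <= (t * u) * d)%R by rewrite !mulr_ge0 ?ltW.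
    rewrite /d in H *; nra.
  by rewrite ler_pM2l.
by rewrite mulry gtr0_sg// mul1e -EFinM addey.
Qed.

Theorem kothe_predual : predual G s p (kothe_dual M NM) (kothe_norm M NM).
Proof.
split.
- by move=> f [].
- move=> k f g [mf foo] [mg goo]; split.
    by apply: measurable_funD => //; exact: measurable_funM.
  apply: le_lt_trans (kothe_norm_lin k mf mg) _.
  rewrite lte_add_pinfty// lte_mul_pinfty//.
- by move=> f [_ foo]; rewrite ge0_fin_numE// kothe_norm_ge0.
- by move=> f _; exact: kothe_norm_ge0.
- move=> K f cK sf; have H := kothe_norm_supported cK sf; split => //.
  have [mf _ foo] := sf; split => //; apply: le_lt_trans H _.
  have fL : Lq_integral p f \is a fin_num by rewrite ge0_fin_numE// Lq_integral_ge0.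
  by rewrite -(fineK fL) -(fineK (cap_fin_num cap_lty cK)) !poweR_EFin -EFinM ltry.
- by move=> f g c [mf _]; exact: kothe_hoelder.
- by move=> f e [mf foo]; exact: kothe_approx.
Qed.

End kothe.

(** * The block space *)

Section interleaving.
Context {R : realType}.
Implicit Types u v : R^nat.

(** Merges two block representations into one of the sum. Both are infinite, so they are shuffled
    rather than concatenated. *)
Definition interleave T (u v : nat -> T) (i : nat) := if odd i then v i./2 else u i./2.

Lemma series_interleave u v k :
  series (interleave u v) k = series u (uphalf k) + series v k./2.
Proof.
elim: k => [|k IHk]; first by rewrite /series /= !big_geq// addr0.
rewrite /series /= big_nat_recr//= -[X in X + _]/(series (interleave u v) k) IHk /interleave.
rewrite uphalf_half; have [ok|ek] := boolP (odd k).
  by rewrite add1n /series /= [X in _ = _ + X]big_nat_recr//= addrA.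
by rewrite add0n /series /= [X in _ = X + _]big_nat_recr//= addrAC.
Qed.

Lemma cvg_interleave u v (a b : R) : series u @ \oo --> a -> series v @ \oo --> b ->
  series (interleave u v) @ \oo --> a + b.
Proof.
move=> ua vb.
have -> : series (interleave u v) = (fun k => series u (uphalf k) + series v k./2).
  by apply/funext => k; rewrite series_interleave.
have half : k./2 @[k --> \oo] --> \oo.
  move=> P [N _ NP]; exists N.*2 => // k /= Nk; apply: NP => /=.
  by rewrite -(doubleK N) half_leq.
have uphalfoo : uphalf k @[k --> \oo] --> \oo.
  move=> P [N _ NP]; exists N.*2 => // k /= Nk; apply: NP => /=.
  by rewrite uphalf_half (leq_trans _ (leq_addl _ _))// -(doubleK N) half_leq.
apply: cvgD; first exact: (cvg_comp _ _ uphalfoo ua).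
exact: (cvg_comp _ _ half vb).
Qed.

Lemma nneseries_interleave_lty (u v : R^nat) :
  (\sum_(0 <= j <oo) `|u j|%:E < +oo)%E -> (\sum_(0 <= j <oo) `|v j|%:E < +oo)%E ->
  (\sum_(0 <= j <oo) `|interleave u v j|%:E < +oo)%E.
Proof.
move=> uoo voo.
have nE (w : R^nat) k : ((series (fun j => `|w j|) k)%:E <= \sum_(0 <= j <oo) `|w j|%:E)%E.
  by rewrite /series /= -sumEFin; apply: nneseries_lim_ge => i _ _; rewrite lee_fin.
apply: (@le_lt_trans _ _ (\sum_(0 <= j <oo) `|u j|%:E + \sum_(0 <= j <oo) `|v j|%:E)%E).
  apply: lime_le; first by apply: is_cvg_nneseries => j _ _; rewrite lee_fin.
  apply/nearW => k; rewrite sumEFin.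
  rewrite (_ : \sum_(0 <= j < k) _ = series (interleave (fun j => `|u j|) (fun j => `|v j|)) k).
    by rewrite series_interleave EFinD leeD.
  by apply: eq_bigr => j _; rewrite /interleave; case: odd.
by rewrite lte_add_pinfty.
Qed.

End interleaving.

Section block_space.
Context {R : realType} {n : nat}.
Local Notation V := 'rV[R]_n.
Local Notation mu := (lebesgue_rV n).
Local Open Scope ereal_scope.
Implicit Types (f g h : V -> R) (K A S D : set V) (e r : R).
Variables (G : V -> R) (s p : R).
Hypothesis p1 : (1 < p)%R.
Local Notation cap := (bessel_cap G s).
Hypothesis cap_lty : forall E : set V, bounded_set E -> cap E < +oo.
Hypothesis cap_eq0 : forall K : set V, measurable K -> cap K = 0 -> mu K = 0.
Local Notation q := (p / (p - 1))%R.
Local Notation M := (M_space G s p).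
Local Notation NM := (M_norm G s p).
Local Notation B := (B_space G s q).
Local Notation NB := (B_norm G s q).

Let p0 : (0 < p)%R. Proof. exact: lt_trans p1. Qed.
Let q0 : (0 < q)%R. Proof. exact: conj_gt0. Qed.

Lemma B_atom_exponent : ((1 - q) / q = - p^-1)%R.
Proof. have := conj_sum p1; rewrite mulrBl mul1r divff ?gt_eqF//; lra. Qed.

Lemma LfunP_Lq f : f \in Lfun mu q%:E <->
  measurable_fun setT f /\ Lq_integral p f < +oo.
Proof.
split; rewrite inE.
  move=> /andP[/[!inE]/= mf] lpf; split => //; rewrite /finite_norm Lnorm_powR in lpf.
  by apply: lty_poweRy lpf; rewrite invr_neq0// gt_eqF.
move=> [mf foo]; apply/andP; split; rewrite inE//=.
by rewrite /finite_norm Lnorm_powR; exact: poweR_lty.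
Qed.

(** Zero blocks pad finite combinations to sequences. *)
Lemma B_atom0 : B_atom G s q (fun=> 0%R).
Proof.
have [[m0 _ _] LE] := @supported_Lq0 R n p p1 set0.
split; first by apply/LfunP_Lq; rewrite LE.
exists set0; split.
- by exists 0%R; split => // M _ x.
- exact/nearW.
- rewrite Lnorm_powR -/(Lq_integral p _) LE poweR0r ?poweR_ge0//.
  by rewrite invr_neq0// gt_eqF.
Qed.

Lemma B_representation0 f : f = cst 0%R %[ae mu] ->
  B_representation G s q f (fun=> 0%R) (fun=> (fun=> 0%R)).
Proof.
move=> f0; split.
- by under eq_eseriesr do rewrite normr0; rewrite eseries0.
- by move=> _; exact: B_atom0.
- apply: filterS f0 => x /(_ I) ->.
  rewrite (_ : series _ = cst 0%R); first exact: cvg_cst.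
  by apply/funext => k; rewrite /series /= big1// => i _; rewrite mulr0.
Qed.

Lemma B_norm_ge0 f : 0 <= NB f.
Proof.
apply: le_ereal_inf_tmp => _ [ca _ <-]; apply: nneseries_ge0 => j _ _.
by rewrite lee_fin.
Qed.

Lemma B_norm_le f c a : B_representation G s q f c a ->
  NB f <= \sum_(0 <= j <oo) `|c j|%:E.
Proof. by move=> H; apply: ereal_inf_lbound; exists (c, a). Qed.

Lemma B_norm_eq0 f : f = cst 0%R %[ae mu] -> NB f <= 0.
Proof.
move=> /B_representation0/B_norm_le; under eq_eseriesr do rewrite normr0.
by rewrite eseries0.
Qed.

Lemma B_norm_fin f : B f -> NB f \is a fin_num.
Proof.
move=> [_ [c [a H]]]; rewrite ge0_fin_numE ?B_norm_ge0//.
by apply: le_lt_trans (B_norm_le H) _; case: H.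
Qed.

Lemma B_space_lin (k : R) f g : B f -> B g -> B (fun x => k * f x + g x)%R.
Proof.
move=> [mf [c [a [coo aP af]]]] [mg [d [b [doo bP bg]]]]; split.
  by apply: measurable_funD => //; exact: measurable_funM.
exists (interleave (fun j => k * c j)%R d), (interleave a b); split.
- apply: nneseries_interleave_lty => //.
  under eq_eseriesr do rewrite normrM EFinM.
  rewrite nneseriesZl; last by move=> j _; rewrite lee_fin.
  by rewrite lte_mul_pinfty.
- by move=> j; rewrite /interleave; case: odd.
- apply: filterS2 af bg => x fx gx.
  rewrite (_ : (fun j => _) = interleave (fun j => k * (c j * a j x))%R (fun j => d j * b j x)%R).
    apply: cvg_interleave => //.
    rewrite (_ : series _ = (fun m => k * series (fun j => c j * a j x) m)%R).
      exact: cvgMr.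
    by apply/funext => m; rewrite /series /= mulr_sumr.
  by apply/funext => j; rewrite /interleave; case: odd; rewrite ?mulrA.
Qed.

(** The degenerate case of [B_supported], in which the normalizing factor would be 0. *)
Lemma supported_ae0 K f : supported_Lq p K f -> measurable K ->
  Lq_integral p f = 0 \/ cap K = 0 -> f = cst 0%R %[ae mu].
Proof.
move=> [mf f0 foo] mK [L0|K0].
  have mq : measurable_fun setT (fun x => (`|f x| `^ q)%:E).
    exact: measurable_powR_norm.
  have : \int[mu]_x `|(`|f x| `^ q)%:E| = 0.
    by under eq_integral do rewrite gee0_abs ?lee_fin ?powR_ge0//.
  move/(ae_eq_integral_abs mu measurableT mq); apply: filterS => x H _.
  have /= [/powR_eq0_eq0/eqP] := H I.
  by rewrite normr_eq0 => /eqP.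
exists K; split => //; first exact: cap_eq0.
by move=> x /= H; apply: contrapT => nK; apply: H => _; exact: f0.
Qed.

(** Divided by the claimed bound [l], the function is a single block, and [l] is then the only
    nonzero coefficient. *)
Lemma B_supported K f : compact K -> supported_Lq p K f ->
  B f /\ NB f <= Lq_integral p f `^ q^-1 * cap K `^ p^-1.
Proof.
move=> cK sf; have [mf f0 foo] := sf; have mK := compact_measurable_rV cK.
have L0 : 0 <= Lq_integral p f by exact: Lq_integral_ge0.
have fL : Lq_integral p f \is a fin_num by rewrite ge0_fin_numE.
have fK := cap_fin_num cap_lty cK.
have [E|NE] := pselect (Lq_integral p f = 0 \/ cap K = 0).
  have fae := supported_ae0 sf mK E; split.
    by split=> //; exists (fun=> 0%R), (fun=> (fun=> 0%R)); exact: B_representation0.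
  by apply: le_trans (B_norm_eq0 fae) _; rewrite mule_ge0// poweR_ge0.
have Ln0 : Lq_integral p f != 0 by apply/eqP => E; apply: NE; left.
have Kn0 : cap K != 0 by apply/eqP => E; apply: NE; right.
pose I := fine (Lq_integral p f); pose k := fine (cap K).
have I0 : (0 < I)%R by rewrite fine_gt0// lt0e Ln0 L0.
have k0 : (0 < k)%R by rewrite fine_gt0// lt0e Kn0 bessel_cap_ge0/= ltey_eq fK.
pose l := (I `^ q^-1 * k `^ p^-1)%R.
have l0 : (0 < l)%R by rewrite mulr_gt0 ?powR_gt0.
pose a x := (l^-1 * f x)%R.
have ma : measurable_fun setT a by exact: measurable_funM.
have LaE : Lq_integral p a = ((l `^ q)^-1 * I)%:E.
  rewrite EFinM /I fineK// -ge0_integralZl//.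
  - apply: eq_integral => x _; rewrite -EFinM normrM powRM// ger0_norm ?invr_ge0 ?(ltW l0)//.
    by rewrite -powR_inv1 ?(ltW l0)// -powRrM mulN1r powRN.
  - exact: measurable_powR_norm.
  - by rewrite lee_fin invr_ge0 powR_ge0.
have aP : B_atom G s q a.
  split; first by apply/LfunP_Lq; rewrite LaE ltry.
  exists K; split; first exact: compact_bounded.
    by apply/nearW => x nK; rewrite /a f0// mulr0.
  rewrite Lnorm_powR -/(Lq_integral p a) LaE B_atom_exponent -(fineK fK) !poweR_EFin -/k.
  rewrite powRM ?invr_ge0 ?powR_ge0 ?(ltW I0)// lee_fin powRN.
  have -> : ((l `^ q)^-1 `^ q^-1 = l^-1)%R.
    rewrite -powR_inv1 ?powR_ge0// -!powRrM mulN1r mulrN divff ?gt_eqF//.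
    by rewrite powR_inv1 ?(ltW l0).
  rewrite /l invfM mulrAC mulVf ?mul1r//.
  by rewrite gt_eqF// powR_gt0.
have rep : B_representation G s q f (fun j => if j == 0%N then l else 0%R)
    (fun j => if j == 0%N then a else fun=> 0%R).
  split.
  - rewrite nneseries_recl//.
    by rewrite eseries0 => [|[|j]//= _ _]; rewrite ?normr0// adde0 ltry.
  - by case=> [|j]//; exact: B_atom0.
  - apply/nearW => x; apply: cvg_near_cst; exists 1%N => // -[|m]//= _.
    rewrite /series /= big_nat_recl//= big1 ?addr0; last by move=> i _; rewrite mul0r.
    by rewrite /a mulrA mulfV ?mul1r// gt_eqF.
split; first by split => //; do 2 eexists; exact: rep.
apply: le_trans (B_norm_le rep) _.
rewrite nneseries_recl//.
rewrite eseries0 => [|[|j]//= _ _]; last by rewrite normr0.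
by rewrite adde0 /= ger0_norm ?(ltW l0)// -(fineK fK) -(fineK fL) !poweR_EFin -EFinM.
Qed.

(** Up to a null set, [S] is an increasing union of compact sets, and each has capacity at most that
    of [A] by monotonicity. [A] is an arbitrary bounded set, possibly not measurable, which is why
    the integral runs over a Borel subset. *)
Lemma M_bound_subset c g A S : (0 <= c)%R -> measurable_fun setT g ->
  M_bound G s p c g -> bounded_set A -> measurable S -> S `<=` A ->
  \int[mu]_(x in S) (`|g x| `^ p)%:E <= (c `^ p)%:E * cap A.
Proof.
move=> c0 mg gc bA mS SA; have [r [_ Ar]] := bounded_subset_cball bA.
have mgp := @measurable_powR_norm R n p g setT mg.
have Sr : S `<=` cball r by exact: subset_trans Ar.
have /choice[K KP] : forall k : nat, exists K, [/\ compact K, K `<=` S &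
    mu (S `\` K) <= (2^-1 ^+ k)%:E].
  move=> k; apply: (inner_regular (lebesgue_rV_cball_lty n r) mS Sr).
  by rewrite exprn_gt0// invr_gt0.
pose U k := \big[setU/set0]_(i < k.+1) K i.
have cU k : compact (U k).
  rewrite /U; elim: k => [|k IHk].
    by rewrite big_ord_recr big_ord0 /= set0U; have [] := KP 0%N.
  by rewrite big_ord_recr/=; apply: compactU => //; have [] := KP k.+1.
have US k : U k `<=` S.
  by rewrite /U -bigcup_mkord => x [i _ Kx]; have [_ + _] := KP i; apply.
have mU k := compact_measurable_rV (cU k).
have mUU : measurable (\bigcup_k U k) by exact: bigcup_measurable.
have mSU : measurable (S `\` \bigcup_k U k) by exact: measurableD.
have N0 : mu (S `\` \bigcup_k U k) = 0.
  apply/eqP; rewrite eq_le measure_ge0 andbT; apply/lee_addgt0Pr => e e0; rewrite add0e.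
  have [k _ /(_ k (leqnn k)) /= ke] : \forall k \near \oo, (2^-1 ^+ k <= e :> R)%R.
    have /cvgrPdist_le/(_ e e0) : (2^-1 ^+ k)%R @[k --> \oo] --> (0%R : R).
      by apply: cvg_expr; rewrite ger0_norm// invf_lt1// ltr1n.
    by apply: filterS => k; rewrite sub0r normrN ger0_norm// exprn_ge0.
  have [cK KS muK] := KP k.
  apply: (@le_trans _ _ (mu (S `\` K k))).
    apply: le_measure; rewrite ?inE//.
      by apply: measurableD => //; exact: compact_measurable_rV.
    apply: setDS => x Kx; exists k => //; rewrite /U big_ord_recr/=; right.
    exact: Kx.
  by apply: (le_trans muK); rewrite lee_fin.
have -> : \int[mu]_(x in S) (`|g x| `^ p)%:E = \int[mu]_(x in \bigcup_k U k) (`|g x| `^ p)%:E.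
  rewrite (ge0_negligible_integral mSU mS _ _ N0)//; last exact: measurable_funTS.
  congr (integral _ _ _); rewrite setDD; apply/setIidPr => x [k _ Ux]; exact: US Ux.
have cv : \int[mu]_(x in U k) (`|g x| `^ p)%:E @[k --> \oo] -->
    \int[mu]_(x in \bigcup_k U k) (`|g x| `^ p)%:E.
  apply: ge0_nondecreasing_set_cvg_integral => //.
    by move=> i j ij; apply/subsetPset; exact: subset_bigsetU.
  by move=> k; exact: measurable_funTS.
apply: (cvge_to_le cv); apply/nearW => k.
apply: le_trans (gc _ (cU k)) _; rewrite lee_wpmul2l ?lee_fin ?powR_ge0//.
by apply: le_bessel_cap; exact: subset_trans SA.
Qed.

Lemma B_atom_hoelder c g a : (0 <= c)%R -> measurable_fun setT g ->
  M_bound G s p c g -> B_atom G s q a -> \int[mu]_x `|a x * g x|%:E <= c%:E.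
Proof.
move=> c0 mg gc [/LfunP_Lq[ma aoo] [A [bA [Z [mZ Z0 aZ]] aA]]].
(* A Borel subset of [A] carrying [a]: the null set [Z] contains all points outside [A] where [a]
   does not vanish. *)
pose S := [set x | a x != 0%R] `\` Z.
have mS : measurable S.
  apply: measurableD => //; rewrite -[X in measurable X]setTI.
  rewrite (_ : [set x | _] = a @^-1` (~` [set 0%R])); last first.
    by apply/seteqP; split => x /= /eqP.
  by apply: ma => //; exact: measurableC.
have SA : S `<=` A.
  move=> x [/= ax nZ]; apply: contrapT => nA; apply: nZ; apply: aZ => /= H.
  by move: ax; rewrite H// eqxx.
have aS : {ae mu, forall x, ~ S x -> a x = 0%R}.
  exists Z; split => // x /= H; apply: contrapT => nZ; apply: H => nS.
  by apply: contrapT => /eqP ax; exact: nS.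
apply: (le_trans (hoelder_on p1 mS ma mg aS)).
have gS := M_bound_subset c0 mg gc bA mS SA.
rewrite Lnorm_powR -/(Lq_integral p a) B_atom_exponent in aA.
have A0 : 0 <= cap A by exact: bessel_cap_ge0.
have fA : cap A \is a fin_num by rewrite ge0_fin_numE//; exact: cap_lty.
apply: (@le_trans _ _ (cap A `^ (- p^-1) * ((c `^ p)%:E * cap A) `^ p^-1)).
  apply: lee_pmul => //; [exact: poweR_ge0|exact: poweR_ge0|].
  apply: gt0_ler_poweR => //.
  - by rewrite invr_ge0 ltW.
  - by rewrite in_itv/= leey andbT; apply: integral_ge0 => x _; rewrite lee_fin powR_ge0.
  - by rewrite in_itv/= leey andbT mule_ge0 ?lee_fin ?powR_ge0.
rewrite -(fineK fA) -[leLHS]/(((fine (cap A)) `^ (- p^-1) *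
  (c `^ p * fine (cap A)) `^ p^-1)%R%:E) lee_fin.
have k0 : (0 <= fine (cap A))%R by exact: fine_ge0.
rewrite powRM ?powR_ge0// -powRrM mulfV ?gt_eqF// powRr1// powRN mulrCA.
(* For capacity 0 the factor 0^(1/p) already vanishes, whatever value its inverse takes. *)
have [->|kn0] := eqVneq (fine (cap A)) 0%R.
  by rewrite powR0 ?invr_neq0 ?gt_eqF// mulr0 mulr0.
by rewrite mulVf ?mulr1// gt_eqF// powR_gt0// lt0r kn0.
Qed.

Lemma B_hoelder f g c : B f -> measurable_fun setT g -> (0 < c)%R ->
  M_bound G s p c g -> \int[mu]_x `|f x * g x|%:E <= c%:E * NB f.
Proof.
move=> Bf mg c0 gc; have [mf _] := Bf.
(* Dividing by c > 0 turns the claim into a lower bound for the infimum over all representations. *)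
rewrite muleC -lee_pdivrMr// muleC; apply: le_ereal_inf_tmp => _ [[d a] /= [doo aP af] <-].
rewrite lee_pdivrMl//.
have ma j : measurable_fun setT (a j) by have [/LfunP_Lq[]] := aP j.
pose F j x := (`|d j|%:E * `|a j x * g x|%:E).
have mag j : measurable_fun setT (fun x => `|a j x * g x|%:E).
  by apply/measurable_EFinP; apply: measurableT_comp => //; exact: measurable_funM.
have mF j : measurable_fun setT (F j) by exact: emeasurable_funM.
have F0 j x : 0 <= F j x by rewrite mule_ge0 ?lee_fin.
apply: (@le_trans _ _ (\int[mu]_x \sum_(0 <= j <oo) F j x)).
  apply: ae_ge0_le_integral => //.
  - by apply/measurable_EFinP; apply: measurableT_comp => //; exact: measurable_funM.
  - by move=> x _; exact: nneseries_ge0.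
  - exact: ge0_emeasurable_sum.
  - apply: filterS af => x fx _.
    have cv : `|series (fun j => d j * a j x)%R k * g x|%:E @[k --> \oo] --> `|f x * g x|%:E.
      apply: cvg_EFin; first exact: nearW.
      by apply: cvg_norm; apply: cvgMl.
    apply: (cvge_to_le cv); apply/nearW => k.
    apply: (@le_trans _ _ (\sum_(0 <= j < k) F j x)); last exact: nneseries_lim_ge.
    rewrite (_ : \sum_(0 <= j < k) F j x = (\sum_(0 <= j < k) `|d j * a j x * g x|)%R%:E).
      by rewrite lee_fin /series /= mulr_suml ler_norm_sum.
    by rewrite -sumEFin; apply: eq_bigr => j _; rewrite /F -mulrA [in RHS]normrM.
rewrite integral_nneseries// -nneseriesZl; last by move=> j _; rewrite lee_fin.
apply: lee_nneseries => [j _ _|j _]; first exact: integral_ge0.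
rewrite /F ge0_integralZl// muleC lee_wpmul2r ?lee_fin//.
by apply: (B_atom_hoelder (ltW c0) mg gc); exact: aP.
Qed.

Lemma supported_LqD K (k : R) f g : supported_Lq p K f -> supported_Lq p K g ->
  supported_Lq p K (fun x => f x + k * g x)%R.
Proof.
move=> [mf f0 foo] [mg g0 goo].
have m (h : V -> R) : measurable_fun setT h -> measurable_fun setT (fun x => (`|h x| `^ q)%:E).
  by move=> mh; exact: measurable_powR_norm.
have mkg : measurable_fun setT (fun x => k * g x)%R by exact: measurable_funM.
split; first exact: measurable_funD.
  by move=> x nx; rewrite f0// g0// mulr0 addr0.
apply: (@le_lt_trans _ _ (\int[mu]_x ((2 `^ q)%:E * ((`|f x| `^ q)%:E + (`|k| `^ q)%:E * (`|g x| `^ q)%:E)))).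
  apply: ge0_le_integral => //.
  - by apply: m; exact: measurable_funD.
  - by apply: emeasurable_funM => //; apply: emeasurable_funD; [exact: m|apply: emeasurable_funM => //; exact: m].
  - move=> x _; rewrite lee_fin (le_trans (ler_powRD _ _ (ltW q0)))//.
    by rewrite normrM (powRM _ (normr_ge0 k) (normr_ge0 (g x))).
rewrite ge0_integralZl// ?lee_fin ?powR_ge0//; last 2 first.
  by apply: emeasurable_funD; [exact: m|apply: emeasurable_funM => //; exact: m].
  by move=> x _; rewrite lee_fin addr_ge0 ?mulr_ge0 ?powR_ge0.
rewrite ge0_integralD//; [|exact: m|apply: emeasurable_funM => //; exact: m].
rewrite ge0_integralZl// ?lee_fin ?powR_ge0//; last exact: m.
apply: lte_mul_pinfty; [by rewrite lee_fin powR_ge0|by []|].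
apply: lte_add_pinfty; first exact: foo.
by apply: lte_mul_pinfty; [rewrite lee_fin powR_ge0|by []|exact: goo].
Qed.

(** A block vanishes off its bounded set only a.e., while [supported_Lq] asks for it everywhere.
    Multiplying it by the indicator of a ball containing that set repairs this by a change on a null
    set. *)
Lemma B_partial_sum (c : R^nat) (a : (V -> R)^nat) m : (forall j, B_atom G s q (a j)) ->
  exists r h, [/\ (0 < r)%R, supported_Lq p (cball r) h &
    {ae mu, forall x, h x = series (fun j => c j * a j x)%R m}].
Proof.
move=> aP; elim: m => [|m [r [h [r0 sh hE]]]].
  exists 1%R, (fun=> 0%R); split => //.
    by have [] := @supported_Lq0 R n p p1 (cball 1%R).
  by apply/nearW => x; rewrite /series /= big_geq.
have [/LfunP_Lq[ma aoo] [A [bA aA _]]] := aP m.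
have [r' [r'0 Ar']] := bounded_subset_cball bA.
pose t := Num.max r r'.
have rt : @cball R n r `<=` cball t by move=> x; rewrite /cball /= le_max => ->.
have r't : @cball R n r' `<=` cball t by move=> x; rewrite /cball /= le_max => ->; rewrite orbT.
pose b x := (a m x * \1_(cball t) x)%R.
have mb : measurable_fun setT b.
  by apply: measurable_funM => //; apply: measurable_indic; exact: measurable_cball.
have sb : supported_Lq p (cball t) b.
  split; first exact: mb.
    by move=> x nx; rewrite /b indicE memNset ?mulr0.
  apply: le_lt_trans aoo; apply: ge0_le_integral => //.
  - exact: measurable_powR_norm.
  - exact: measurable_powR_norm.
  - move=> x _; rewrite lee_fin ge0_ler_powR ?nnegrE ?(ltW q0)//.
    by rewrite /b indicE; case: (x \in _); rewrite ?mulr1// mulr0 normr0.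
exists t, (fun x => h x + c m * b x)%R; split.
- by rewrite lt_max r0.
- exact: supported_LqD (supported_LqS rt sh) sb.
- apply: filterS2 hE aA => x hx ax; rewrite hx /series /= big_nat_recr//=; congr (_ + c m * _)%R.
  rewrite /b indicE; have [xt|xt] := boolP (x \in cball t); first by rewrite mulr1.
  by rewrite mulr0 ax// => /Ar' /r't /mem_set; exact/negP.
Qed.

(** The remainder after m terms is represented by the shifted sequences, so its norm is at most the
    tail of the sum of the |c_j|. *)
Lemma B_approx f e : B f -> (0 < e)%R -> exists K h,
  [/\ compact K, supported_Lq p K h & NB (fun x => -1 * h x + f x)%R <= e%:E].
Proof.
move=> [mf [c [a [coo aP af]]]] e0.
have [m mE] : exists m, \sum_(m <= j <oo) `|c j|%:E <= e%:E.
  have c0 k : true -> 0 <= `|c k|%:E by rewrite lee_fin.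
  have /fine_cvgP[tfin /cvgrPdist_le/(_ e e0) te] := nneseries_tail_cvg coo c0.
  have [m _ /(_ m (leqnn m))[fm me]] : \forall m \near \oo,
      (\sum_(m <= j <oo) `|c j|%:E \is a fin_num) /\
      (`|0 - fine (\sum_(m <= j <oo) `|c j|%:E)| <= e)%R.
    by near=> m; split; near: m.
  exists m; rewrite -(fineK fm) lee_fin (le_trans (ler_norm _))//.
  by rewrite -normrN -sub0r.
have [r [h [r0 sh hE]]] := B_partial_sum c m aP.
exists (cball r), h; split => //; first exact: compact_cball.
have tE : \sum_(0 <= j <oo) `|c (j + m)%N|%:E = \sum_(m <= j <oo) `|c j|%:E.
  by rewrite -(nneseries_addn m (f := fun j => `|c j|%:E))// => j; rewrite lee_fin.
apply: (le_trans _ mE); rewrite -tE; apply: (@B_norm_le _ _ (fun j => a (j + m)%N)); split.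
- by rewrite tE (le_lt_trans mE)// ltry.
- by move=> j; exact: aP.
- apply: filterS2 af hE => x fx hx.
  have -> : series (fun j => c (j + m)%N * a (j + m)%N x)%R =
      (fun k => -1 * h x + series (fun j => c j * a j x)%R (k + m)%N)%R.
    apply/funext => k; rewrite hx /series /= [X in _ = (_ + X)%R](@big_cat_nat _ _ _ m)//= ?leq_addl//.
    by rewrite mulN1r addKr -[X in _ = (\sum_(X <= _ < _) _)%R](add0n m) big_addn addnK.
  apply: cvgD; first exact: cvg_cst.
  by move: fx; rewrite -(cvg_shiftn m).
Unshelve. all: by end_near. Qed.

Theorem B_predual : predual G s p B NB.
Proof.
split.
- by move=> f [].
- exact: B_space_lin.
- exact: B_norm_fin.
- by move=> f _; exact: B_norm_ge0.
- exact: B_supported.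
- exact: B_hoelder.
- exact: B_approx.
Qed.

End block_space.

Theorem theorem1p6 (R : realType) (n : nat) (p alpha s : R)
    (G : 'rV[R]_n -> R) (hn : (1 <= n)%N) (hp : 1 < p) (halpha : 0 < alpha)
    (hs : 1 < s) (hG : is_bessel_kernel alpha G) :
  let M := M_space G s p in
  let NM := M_norm G s p in
  let p' := p / (p - 1) in
  dual_isometric (kothe_dual M NM) (kothe_norm M NM) M NM /\
  dual_isometric (B_space G s p') (B_norm G s p') M NM.
Proof.
move=> M NM p'; have [iG _] := hG.
have cap_lty (E : set 'rV[R]_n) : bounded_set E -> (bessel_cap G s E < +oo)%E.
  exact: (bessel_cap_lty (lt_trans ltr01 hs) iG (integral_fourier_bessel hG)).
have cap_eq0 (K : set 'rV[R]_n) := @bessel_cap_eq0 _ _ G s K hs iG.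
split; apply: (predual_dual_isometric hp cap_lty cap_eq0).
- exact: (kothe_predual hp cap_lty cap_eq0).
- exact: (B_predual hp cap_lty cap_eq0).
Qed.
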